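(* Let $d\ge1$, $2<p<\infty$ and $1\leqslant q<\infty$, and let $q'$ be the dual exponent ($\frac1q+\frac1{q'}=1$, $q'=\infty$ if $q=1$). Let $\mu$ be a measure of bounded variation on $\mathbb{R}^d$ such that $\hat{\mu}\in L_{p,q}(\mathbb{R}^d)$. Then for every set $A\subset\mathbb{R}^d$ with $\mathcal{H}_{\frac{2d}{p},\frac{q'}{2}}(A)<\infty$ we have $\mu(A)=0$.
   Context: Lorentz spaces: for a measure space $(X,\mu)$ and $p,q\in(0,\infty)$, $\|f\|^q_{L_{p,q}}=q\int_0^\infty (m_f(t)t^p)^{q/p}\frac{dt}{t}$, where $m_f(t)=\mu(\{x: |f(x)|\geqslant t\})$. Netrusov--Hausdorff capacity: let $\Delta_k=[2^{-k-1},2^{-k})$ for $k\in\mathbb{Z}$. For $F\subset\mathbb{R}^d$, $\alpha>0$, $\delta>0$ and $0<\beta<\infty$ set $\mathcal{H}_{\alpha,\beta}(F,\delta)=\inf\big\{\sum_{k}\big(\sum_{j:\,\operatorname{diam}B_j\in\Delta_k}(\operatorname{diam}B_j)^\alpha\big)^\beta : F\subset\bigcup_j B_j,\ \operatorname{diam}B_j<\delta\big\}$ (countable covers), for $\beta=\infty$ replace $\sum_k(\cdot)^\beta$ by $\sup_k(\cdot)$, and $\mathcal{H}_{\alpha,\beta}(F)=\lim_{\delta\to0}\mathcal{H}_{\alpha,\beta}(F,\delta)$. *)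

(* Defs.v *)
From HB Require Import structures.
From mathcomp Require Import all_boot all_order all_algebra.
From mathcomp Require Import all_classical all_reals all_analysis.
Set Implicit Arguments.
Unset Strict Implicit.
Unset Printing Implicit Defensive.
Import Order.TTheory GRing.Theory Num.Theory.
Import numFieldNormedType.Exports.
Local Open Scope classical_set_scope.
Local Open Scope ring_scope.

(** R^d is modelled as [d.-tuple R]; its canonical measurable structure in
    MathComp-Analysis is the product sigma-algebra generated by the coordinate
    projections (= Borel sets of R^d). *)

Section Defs.
Variable R : realType.

Definition dotp (d : nat) (x y : d.-tuple R) : R :=
  \sum_(i < d) tnth x i * tnth y i.

Definition edist (d : nat) (x y : d.-tuple R) : R :=
  Num.sqrt (\sum_(i < d) (tnth x i - tnth y i) ^+ 2).

(** Open Euclidean ball B(c, r). For r > 0 (and d >= 1) its diameter is 2 r;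
    for r = 0 it is empty. *)
Definition eball (d : nat) (c : d.-tuple R) (r : R) : set (d.-tuple R) :=
  [set x | edist x c < r].

Definition box (d : nat) (a b : d.-tuple R) : set (d.-tuple R) :=
  [set x | forall i : 'I_d, tnth a i <= tnth x i <= tnth b i].

Definition box_vol (d : nat) (a b : d.-tuple R) : R :=
  \prod_(i < d) (tnth b i - tnth a i).

Definition lebesgue_outer (d : nat) (E : set (d.-tuple R)) : \bar R :=
  ereal_inf [set s | exists a b : nat -> d.-tuple R,
    (forall k (i : 'I_d), tnth (a k) i <= tnth (b k) i) /\
    E `<=` \bigcup_k box (a k) (b k) /\
    s = (\sum_(k <oo) (box_vol (a k) (b k))%:E)%E].

(** Fourier transform of a complex measure of bounded variation
    mu = (mu1 - mu2) + i (mu3 - mu4), with mu1,...,mu4 finite (positive)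
    Borel measures (Jordan decomposition of real and imaginary parts);
    hat mu(xi) = \int exp(-2 pi i <x,xi>) dmu(x). We only need |hat mu|. *)
Section Fourier.
Variable d : nat.
Variables mu1 mu2 mu3 mu4 : {finite_measure set (d.-tuple R) -> \bar R}.

Definition cosint (m : {finite_measure set (d.-tuple R) -> \bar R})
  (xi : d.-tuple R) : R :=
  Rintegral m setT (fun x => cos (2 * pi * dotp x xi)).
Definition sinint (m : {finite_measure set (d.-tuple R) -> \bar R})
  (xi : d.-tuple R) : R :=
  Rintegral m setT (fun x => sin (2 * pi * dotp x xi)).

Definition fourier_re (xi : d.-tuple R) : R :=
  (cosint mu1 xi - cosint mu2 xi) + (sinint mu3 xi - sinint mu4 xi).
Definition fourier_im (xi : d.-tuple R) : R :=
  (cosint mu3 xi - cosint mu4 xi) - (sinint mu1 xi - sinint mu2 xi).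

Definition fourier_abs (xi : d.-tuple R) : R :=
  Num.sqrt (fourier_re xi ^+ 2 + fourier_im xi ^+ 2).
End Fourier.

Definition distrib (d : nat) (f : d.-tuple R -> R) (t : R) : \bar R :=
  lebesgue_outer [set x | t <= `|f x|].

Definition lorentz_pow (d : nat) (f : d.-tuple R -> R) (p q : R) : \bar R :=
  (q%:E * \int[@lebesgue_measure R]_(t in [set t : R | (0 < t)%R])
     (poweR (distrib f t * (powR t p)%R%:E) (q / p)%R * (t^-1)%R%:E))%E.

Definition in_lorentz (d : nat) (f : d.-tuple R -> R) (p q : R) : Prop :=
  (lorentz_pow f p q < +oo)%E.

(** Netrusov--Hausdorff capacity. A countable cover is given by centres c j
    and radii r j >= 0 (open balls; diam B_j = 2 r j). *)
Definition dyadic_level (k : int) (s : R) : Prop :=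
  (2%:R ^ (- k - 1) <= s) /\ (s < 2%:R ^ (- k)).

Definition level_sum (alpha : R) (r : nat -> R) (k : int) : \bar R :=
  (\sum_(j <oo | `[< dyadic_level k (2 * r j) >]) (powR (2 * r j) alpha)%:E)%E.

Definition cover_cost (alpha : R) (beta : \bar R) (r : nat -> R) : \bar R :=
  match beta with
  | b%:E => (\esum_(k in [set: int]) poweR (level_sum alpha r k) b)%E
  | _ => ereal_sup (range (level_sum alpha r))
  end.

Definition NH_delta (d : nat) (alpha : R) (beta : \bar R)
  (F : set (d.-tuple R)) (delta : R) : \bar R :=
  ereal_inf [set s | exists (c : nat -> d.-tuple R) (r : nat -> R),
    (forall j, 0 <= r j) /\ (forall j, 2 * r j < delta) /\
    F `<=` \bigcup_j eball (c j) (r j) /\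
    s = cover_cost alpha beta r].

(* H(F) = lim_{delta -> 0} H(F, delta); since H(F, delta) is nonincreasing
   in delta, this limit is the supremum over delta > 0. *)
Definition NH (d : nat) (alpha : R) (beta : \bar R) (F : set (d.-tuple R))
  : \bar R :=
  ereal_sup [set NH_delta alpha beta F delta | delta in [set delta : R | 0 < delta]].

Definition dual_exp (q : R) : \bar R :=
  if q == 1 then +oo%E else (q / (q - 1))%:E.

End Defs.

(* Main.v *)
Require Import Defs.
From HB Require Import structures.
From mathcomp Require Import all_boot all_order all_algebra.
From mathcomp Require Import all_classical all_reals all_analysis.
From mathcomp Require Import measurable_realfun ring lra zify.
Set Implicit Arguments.
Unset Strict Implicit.
Unset Printing Implicit Defensive.
Import Order.TTheory GRing.Theory Num.Theory.
Import numFieldNormedType.Exports.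
Local Open Scope classical_set_scope.
Local Open Scope ring_scope.

(* Let [tent u = max (0, 1 - |u|)]. It is the characteristic function of a
   probability on R with bounded density, hence products of tents are
   characteristic functions of a probability Q on R^d with bounded density. As
   tent vanishes at the nonzero integers, the integer frequencies are orthonormal
   in L^2(Q). So if [psi = \sum_n c_n tau_n], where the [tau_n] are the hats
   [x |-> \prod_i tent (2 ^ k x_i - n_i)], then Cauchy-Schwarz yields
     |\int psi dRe(mu)| ^ 2 <= (\sum_n c_n ^ 2) E_k,
     E_k = \int |hat mu (2 ^ k z)| ^ 2 dQ(z),
   without Plancherel or smoothing. Rearranging hat mu, the bounded density of Q
   and p > 2 turn hat mu in L_{p,q} into l^q control of
   [2 ^ (k d / p) E_k ^ (1/2)].
   Given a cover of A of small mesh, sandwich F <= A <= U up to small mass, with F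
   at positive distance from the complement of U. Start from a coarse spline equal
   to 1 on F and supported in U. At level k split off the hats that meet a ball of
   diameter about [2 ^ - k], and refine the rest to level k + 1. The number of hats
   split off at level k is controlled by the level sum of the cover, so Young's
   inequality bounds the total of the split parts by a tail of the l^q sum, and
   the remainder vanishes on the union of the balls. *)

(** The exponents come from counting. At level k about [2 ^ (2 k d / p)] times the level sum hats
    are split off, with coefficients in [0, 1]; Cauchy-Schwarz then gives the square root of the
    level sum times [2 ^ (k d / p) E_k ^ (1/2)]. Finite capacity of exponent [q' / 2] bounds these
    square roots in l^q', dual to the l^q control of the other factor. The capacity weighs each size
    of ball separately, and a large ball resolved on a fine lattice would cost too many hats. Hence
    the passage through all levels, where a ball only meets hats of its own size. It works because
    the coefficients of a spline are its values at the nodes: a remainder with values in [0, 1],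
    once refined, again has coefficients in [0, 1]. The condition p > 2 enters through the high
    values of hat mu: those taken on sets of measure [2 ^ ((k - i) d)] have Q-mass of order
    [2 ^ (- i d)] in [E_k], while their squares grow only like [2 ^ (2 i d / p)]. *)

Lemma bounded_integrable d (T : measurableType d) (R : realType)
    (m : {finite_measure set T -> \bar R}) (M : R) (f : T -> R) :
  measurable_fun setT f -> (forall x, `|f x| <= M) ->
  m.-integrable setT (EFin \o f).
Proof.
move=> mf fM; apply: measurable_bounded_integrable => //.
  exact: fin_num_fun_lty.
exists M; split; first exact: num_real.
by move=> x Mx y _ /=; exact: le_trans (fM y) (ltW Mx).
Qed.

Lemma Rintegral_le_bound d (T : measurableType d) (R : realType)
    (m : {finite_measure set T -> \bar R}) (f : T -> R) (M : R) :
  measurable_fun setT f -> (forall x, `|f x| <= M) ->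
  `|Rintegral m setT f| <= M * fine (m setT).
Proof.
move=> mf fM; have If := bounded_integrable m mf fM.
apply: (le_trans (le_normr_Rintegral measurableT If)).
rewrite -(Rintegral_cst m measurableT); apply: le_Rintegral => //.
  by apply: (@bounded_integrable _ _ _ m M) => [|x];
    [exact: measurableT_comp|rewrite normr_id].
by apply: (@bounded_integrable _ _ _ m `|M|) => //; exact: measurable_cst.
Qed.

(** * Probabilities given by a density on the line *)

Section density.
Context (R : realType).
Notation mu := (@lebesgue_measure R).
Variable w : R -> R.
Hypothesis w0 : forall x, 0 <= w x.
Hypothesis mw : measurable_fun setT w.
Hypothesis intw : (\int[mu]_x (w x)%:E = 1)%E.

Lemma density_probability : exists P : probability (measurableTypeR R) R,
  forall A, P A = (\int[mu]_(x in A) (w x)%:E)%E.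
Proof.
pose m (A : set (measurableTypeR R)) := (\int[mu]_(x in A) (w x)%:E)%E.
have m0 : m set0 = 0%E by rewrite /m integral_set0.
have mge A : (0 <= m A)%E by apply: integral_ge0 => x _; rewrite lee_fin.
have msa : semi_sigma_additive m.
  move=> /= F mF tF mUF; rewrite /m; apply: cvg_toP.
    apply: ereal_nondecreasing_is_cvgn => a b ab.
    by apply: lee_sum_nneg_natr => // k _ _; exact: mge.
  rewrite ge0_integral_bigcup//=; last by move=> x _; rewrite lee_fin.
  exact/measurable_funTS/measurableT_comp.
have mT : m setT = 1%E by rewrite /m intw.
pose mix1 := isMeasure.Build _ _ _ m m0 mge msa.
pose m1 : {measure set (measurableTypeR R) -> \bar R} := HB.pack m mix1.
pose mix2 := @Measure_isProbability.Build _ _ R m1 mT.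
pose P : probability (measurableTypeR R) R := HB.pack m mix1 mix2.
by exists P.
Qed.

(** [P] is dominated by Lebesgue measure, and its Radon-Nikodym derivative is [w] almost everywhere,
    as both have the same integral over every measurable set. *)
Lemma Rintegral_density (P : probability (measurableTypeR R) R) (f : R -> R)
    (M : R) : (forall A, P A = (\int[mu]_(x in A) (w x)%:E)%E) ->
  measurable_fun setT f -> (forall x, `|f x| <= M) ->
  Rintegral P setT f = Rintegral mu setT (fun x => f x * w x).
Proof.
move=> PE mf fM.
have If : P.-integrable setT (EFin \o f) by exact: (bounded_integrable P mf fM).
have Pmu : P `<< mu.
  apply/null_content_dominatesP => A mA A0; rewrite PE.
  rewrite -(@integral_abs_eq0 _ _ _ mu A (EFin \o w))//=; last first.
    exact/measurable_funTS/measurableT_comp.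
  by apply: eq_integral => x _; rewrite ger0_norm.
have Iw : mu.-integrable setT (EFin \o w).
  apply/integrableP; split; first exact/measurable_EFinP.
  under eq_integral do rewrite /= ger0_norm//.
  by rewrite intw ltry.
rewrite /Rintegral; congr fine.
rewrite -(Radon_Nikodym_change_of_variables Pmu)//=.
under [RHS]eq_integral do rewrite EFinM.
apply: ae_eq_integral => //.
- apply: emeasurable_funM => //=; first exact: (measurable_int P).
- apply: emeasurable_funM; first exact: (measurable_int P If).
  exact: (measurable_int mu Iw).
- apply: ae_eqe_mul2l => /=.
  apply: integral_ae_eq => //=.
  + by apply: Radon_Nikodym_integrable; exact: Pmu.
  + exact/measurable_EFinP.
  + by move=> E E01 mE; rewrite -PE -Radon_Nikodym_integral//; exact: Pmu.
Qed.
End density.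

(** * The tent as a characteristic function *)

Section tent.
Context (R : realType).
Notation mu := (@lebesgue_measure R).

Definition tent (u : R) : R := Num.max 0 (1 - `|u|).

(** As a second difference of [|u|] the tent can be matched with integrals proportional to [|a|],
    and refinement and partition of unity become linear identities. *)
Lemma tentE (u : R) : tent u = (`|u + 1| + `|u - 1| - 2 * `|u|) / 2.
Proof.
rewrite /tent maxEle.
case: (ger0P u) => u0; case: (ger0P (u + 1)) => u1;
  case: (ger0P (u - 1)) => u2; case: ifPn; rewrite -?ltNge; lra.
Qed.

Definition versine (a z : R) : R := (1 - cos (a * z)) / z ^+ 2.

Lemma versine_ge0 (a z : R) : 0 <= versine a z.
Proof. by rewrite divr_ge0 ?sqr_ge0// subr_ge0 cos_le1. Qed.

Lemma measurable_cosM (a : R) : measurable_fun setT (fun z => cos (a * z)).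
Proof.
apply: continuous_measurable_fun => x; apply: continuous_comp.
  by apply: continuousM; [exact: cvg_cst|exact: cvg_id].
exact: continuous_cos.
Qed.

Lemma measurable_sinM (a : R) : measurable_fun setT (fun z => sin (a * z)).
Proof.
apply: continuous_measurable_fun => x; apply: continuous_comp.
  by apply: continuousM; [exact: cvg_cst|exact: cvg_id].
exact: continuous_sin.
Qed.

Lemma measurable_versine (a : R) : measurable_fun setT (versine a).
Proof.
apply: measurable_funM.
  by apply: measurable_funB => //; exact: measurable_cosM.
rewrite (_ : (fun _ => _) = (@powR R ^~ (-1)) \o (fun z => z ^+ 2)); last first.
  by apply/funext => z /=; rewrite powR_inv1// sqr_ge0.
by apply: measurableT_comp; [exact: measurable_powR|exact: measurable_funX].
Qed.

Lemma sin_le_self (x : R) : 0 <= x -> `|sin x| <= x.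
Proof.
rewrite le_eqVlt => /predU1P[<-|x0]; first by rewrite sin0 normr0.
have [c _] := @MVT_segment R sin cos 0 x (ltW x0)
  (fun z _ => is_derive_sin z) (continuous_subspaceT (@continuous_sin R)).
rewrite sin0 !subr0 => ->.
by rewrite normrM (gtr0_norm x0) ler_piMl ?cos_max// ltW.
Qed.

Lemma versin_le (z : R) : 1 - cos z <= z ^+ 2 / 2.
Proof.
have -> : z = (z / 2) *+ 2 by rewrite -mulr_natr; lra.
rewrite cos_mulr2n.
have := cos2Dsin2 (z / 2).
have : sin (z / 2) ^+ 2 <= (z / 2) ^+ 2.
  rewrite -(ler_sqrt _ (sqr_ge0 _)) !sqrtr_sqr.
  case: (ger0P (z / 2)) => zz; first exact: sin_le_self.
  by rewrite -normrN -sinN sin_le_self// oppr_ge0 ltW.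
rewrite -mulr_natr; nra.
Qed.

(** This is the source of the bounded density of the tent probability. *)
Lemma versine_le (a z : R) : versine a z <= a ^+ 2 / 2.
Proof.
have [->|z0] := eqVneq z 0.
  by rewrite /versine mulr0 cos0 subrr mul0r divr_ge0 ?sqr_ge0.
rewrite /versine ler_pdivrMr ?exprn_even_gt0//.
by rewrite (le_trans (versin_le _))// exprMn mulrAC.
Qed.

(** From [1 - cos z <= z ^ 2 / 2] and [1 - cos z <= 2]; comparison with the Cauchy density makes the
    versine integrable. *)
Lemma versine1_le_oneDsqr (z : R) : versine 1 z <= 4 * (oneDsqr z)^-1.
Proof.
rewrite /versine mul1r.
have [->|z0] := eqVneq z 0.
  by rewrite cos0 subrr mul0r mulr_ge0// invr_ge0 (le_trans _ (oneDsqr_ge1 _)).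
rewrite -[4 * _]/(4 / _) ler_pdivrMr ?exprn_even_gt0//.
rewrite mulrAC ler_pdivlMr; last by rewrite (lt_le_trans _ (oneDsqr_ge1 _)).
have h := versin_le z.
rewrite /oneDsqr.
have := cos_geN1 z.
have := sqr_ge0 z; nra.
Qed.

Lemma integral_versineN (a : R) :
  (\int[mu]_z (versine (- a) z)%:E = \int[mu]_z (versine a z)%:E)%E.
Proof. by apply: eq_integral => z _; rewrite /versine mulNr cosN. Qed.

Definition dilation (a : R) : R -> measurableTypeR R := fun z => a * z.

Lemma measurable_dilation (a : R) :
  measurable_fun [set: measurableTypeR R] (dilation a).
Proof. exact: mulrl_measurable. Qed.

(** Both sides are measures in [A] that agree on half-open intervals, and these determine Lebesgue
    measure. *)
Lemma lebesgue_measure_dilation (a : R) (A : set (measurableTypeR R)) :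
  0 < a -> measurable A -> (a%:E * pushforward mu (dilation a) A = mu A)%E.
Proof.
move=> a0 mA.
pose pf : {measure set (measurableTypeR R) -> \bar R} :=
  pushforward mu (dilation a).
pose m : {measure set (measurableTypeR R) -> \bar R} :=
  mscale (NngNum (ltW a0)) (pf (measurable_dilation a)).
have mE (B : set (measurableTypeR R)) :
  m B = (a%:E * pushforward mu (dilation a) B)%E by [].
rewrite -mE; apply/esym/lebesgue_measure_unique => //= _ [[x y] _ <-].
rewrite mE /pushforward.
have -> : dilation a @^-1` `]x, y] = [set` `](x / a), (y / a)]].
  apply/seteqP; split => z; rewrite /= !in_itv/= ltr_pdivrMr// ler_pdivlMr//;
   by rewrite mulrC.
rewrite !lebesgue_measure_itv/= !lte_fin ltr_pM2r ?invr_gt0//.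
case: ifPn => xy; last by rewrite mule0.
by rewrite -!EFinB -EFinM; congr EFin; field; rewrite gt_eqF.
Qed.

(** [versine a z = a ^ 2 * versine 1 (a * z)], and the change of variables gives back one factor
    [a]. *)
Lemma integral_versineM (a : R) : 0 < a ->
  (\int[mu]_z (versine a z)%:E = a%:E * \int[mu]_z (versine 1 z)%:E)%E.
Proof.
move=> a0.
pose g (z : measurableTypeR R) := (a ^+ 2 * versine 1 z)%:E.
have -> : (\int[mu]_z (versine a z)%:E = \int[mu]_z ((g \o dilation a) z))%E.
  apply: eq_integral => z _ /=; rewrite /g /dilation /versine mul1r; congr EFin.
  have [->|z0] := eqVneq z 0; first by rewrite mulr0 cos0 !subrr !mul0r mulr0.
  by field; rewrite z0 gt_eqF.
rewrite -[in LHS](preimage_setT (dilation a)).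
rewrite -(@ge0_integral_pushforward _ _ _ _ _ _ (measurable_dilation a) mu)//=; last 2 first.
- apply/measurable_EFinP/measurable_funM => //; exact: measurable_versine.
- by move=> z _; rewrite lee_fin mulr_ge0 ?versine_ge0 ?sqr_ge0.
have ai : 0 <= a^-1 by rewrite invr_ge0 ltW.
transitivity (\int[mscale (NngNum ai) mu]_z g z)%E.
  apply: eq_measure_integral => [|? A mA _]; first exact: measurable_dilation.
  change (pushforward mu (dilation a) A = (a^-1)%:E * mu A)%E.
  rewrite -(lebesgue_measure_dilation a0 mA) muleA -EFinM.
  by rewrite mulVf ?gt_eqF// mul1e.
rewrite ge0_integral_mscale//=; last 2 first.
- apply/measurable_EFinP/measurable_funM => //; exact: measurable_versine.
- by move=> z _; rewrite lee_fin mulr_ge0 ?versine_ge0 ?sqr_ge0.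
under eq_integral => z _ do rewrite /g EFinM.
rewrite ge0_integralZl//; last 3 first.
- by apply/measurable_EFinP; exact: measurable_versine.
- by move=> z _; rewrite lee_fin versine_ge0.
- by rewrite lee_fin sqr_ge0.
rewrite muleA -EFinM; congr (_%:E * _)%E.
by field; rewrite gt_eqF.
Qed.

Lemma integral_versine1_lty : (\int[mu]_z (versine 1 z)%:E < +oo)%E.
Proof.
have mo : measurable_fun setT (fun z : R => (4 * (oneDsqr z)^-1)%:E).
  apply/measurable_EFinP/measurable_funM => //.
  apply: continuous_measurable_fun; exact: continuous_oneDsqrV.
have o0 (z : R) : (0 <= (4 * (oneDsqr z)^-1)%:E)%E.
  by rewrite lee_fin mulr_ge0// invr_ge0 (le_trans _ (oneDsqr_ge1 _)).
apply: (@le_lt_trans _ _ (\int[mu]_z (4 * (oneDsqr z)^-1)%:E)%E).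
  apply: ge0_le_integral => //.
  - by move=> z _; rewrite lee_fin versine_ge0.
  - apply/measurable_EFinP; exact: measurable_versine.
  - by move=> z _; rewrite lee_fin versine1_le_oneDsqr.
have h : (\int[mu]_(z in `[0%R, +oo[) (4 * (oneDsqr z)^-1)%:E < +oo)%E.
  under eq_integral do rewrite EFinM.
  rewrite ge0_integralZl//; last first.
    apply/measurable_EFinP/measurable_funTS.
    by apply: continuous_measurable_fun; exact: continuous_oneDsqrV.
  by rewrite integral0y_oneDsqr -EFinM ltry.
have U' : `]-oo, 0%R[ `|` `[0%R, +oo[ = [set: R].
  apply/seteqP; split => // z _; have [z0|z0] := leP 0 z; [right|left];
    by rewrite /= in_itv/= ?andbT// ltW.
rewrite -U' ge0_integral_setU//; last 2 first.
- by rewrite U'.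
- by apply/disj_setPS => z /=; rewrite !in_itv/= andbT => -[z0]; rewrite leNgt z0.
rewrite integral_itv_bndo_bndc; last exact: measurable_funTS.
rewrite lte_add_pinfty//.
move: h; rewrite ge0_integration_by_substitution0//.
under eq_integral => z _ do rewrite /oneDsqr sqrrN.
by [].
Qed.

(** On []pi / 2, pi]] the cosine is nonpositive and [z <= pi], so the integrand is at least
    [pi ^- 2]. *)
Lemma integral_versine1_gt0 : (0 < \int[mu]_z (versine 1 z)%:E)%E.
Proof.
have p2 : 0 < pi / 2 :> R by rewrite divr_gt0// pi_gt0.
apply: (@lt_le_trans _ _ (\int[mu]_(z in `](pi / 2)%R, pi]) (pi ^- 2)%:E)%E).
  rewrite integral_cst//= lebesgue_measure_itv/= lte_fin ifT; last by lra.
  by rewrite -EFinD -EFinM lte_fin mulr_gt0// ?invr_gt0 ?exprn_gt0 ?pi_gt0//; lra.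
apply: (@le_trans _ _ (\int[mu]_(z in `](pi / 2)%R, pi]) (versine 1 z)%:E)%E).
  apply: ge0_le_integral => //.
  - by move=> z _; rewrite lee_fin invr_ge0 exprn_ge0// pi_ge0.
  - apply/measurable_EFinP/measurable_funTS; exact: measurable_versine.
  - move=> z; rewrite /= in_itv/= => /andP[z1 z2].
    have z0 : 0 < z by exact: lt_trans z1.
    rewrite lee_fin /versine mul1r -[leLHS]mul1r.
    apply: ler_pM => //.
    + by rewrite invr_ge0 exprn_ge0// pi_ge0.
    + rewrite lerBrDr gerDl -oppr_ge0.
      rewrite -(subrK pi z) cosDpi opprK cos_ge0_pihalf//; lra.
    + by rewrite lef_pV2 ?posrE ?exprn_gt0 ?pi_gt0// lerXn2r ?nnegrE ?pi_ge0// ltW.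
apply: ge0_subset_integral => //.
  apply/measurable_EFinP; exact: measurable_versine.
by move=> z _; rewrite lee_fin versine_ge0.
Qed.


(** The constant [c] remains abstract; it is absorbed into the normalisation of the density. *)
Lemma integral_versine : exists2 c : R, 0 < c &
  forall a, (\int[mu]_z (versine a z)%:E = (c * `|a|)%:E)%E.
Proof.
set J := (\int[mu]_z (versine 1 z)%:E)%E.
have JE : J = (fine J)%:E.
  by rewrite fineK// ge0_fin_numE ?integral_versine1_lty// ltW ?integral_versine1_gt0.
exists (fine J); first by rewrite -lte_fin -JE integral_versine1_gt0.
move=> a; have [a0|a0|->] := ltgtP a 0.
- rewrite -integral_versineN integral_versineM ?oppr_gt0// -/J JE -EFinM mulrC.
  by rewrite ltr0_norm.
- by rewrite integral_versineM// -/J JE -EFinM mulrC gtr0_norm.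
- rewrite normr0 mulr0; apply: integral0_eq => z _.
  by rewrite /versine mul0r cos0 subrr mul0r.
Qed.

(* [sin (pi z) ^+ 2 / z ^+ 2 * cos (2 pi u z)] is a combination of three
   versines, whose integrals are proportional to [|u + 1|], [|u - 1|], [|u|]. *)
Lemma tent_char : exists2 P : probability (measurableTypeR R) R,
  (exists C : R, forall a b, a <= b -> (P [set` `[a, b]] <= (C * (b - a))%:E)%E) &
  forall u, Rintegral P setT (fun z => cos (2 * pi * (u * z))) = tent u /\
            Rintegral P setT (fun z => sin (2 * pi * (u * z))) = 0.
Proof.
have [c c0 Jc] := integral_versine.
have Iv a : mu.-integrable setT (EFin \o versine a).
  apply/integrableP; split.
    by apply/measurable_EFinP; exact: measurable_versine.
  under eq_integral do rewrite /= ger0_norm ?versine_ge0//.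
  by rewrite Jc ltry.
have RJ a : Rintegral mu setT (versine a) = c * `|a| by rewrite /Rintegral Jc.
have p0 : 0 < pi :> R by exact: pi_gt0.
(* The total mass of [w] is [k / 2 * (c * (2 * pi))], which this choice makes 1. *)
pose k := (pi * c)^-1.
have k0 : 0 < k by rewrite invr_gt0 mulr_gt0.
pose w z := k / 2 * versine (2 * pi) z.
have w0 z : 0 <= w z by rewrite mulr_ge0 ?versine_ge0// divr_ge0 ?ltW.
have mw : measurable_fun setT w.
  by apply: measurable_funM => //; exact: measurable_versine.
have intw : (\int[mu]_z (w z)%:E = 1)%E.
  under eq_integral do rewrite EFinM.
  rewrite ge0_integralZl//; last 3 first.
  - by apply/measurable_EFinP; exact: measurable_versine.
  - by move=> z _; rewrite lee_fin versine_ge0.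
  - by rewrite lee_fin divr_ge0 ?ltW.
  rewrite Jc -EFinM; congr EFin.
  rewrite gtr0_norm ?mulr_gt0// /k; move: (pi : R) p0 => y y0; field.
  by rewrite !gt_eqF.
have [P PE] := density_probability w0 mw intw.
exists P.
  exists (k / 2 * ((2 * pi) ^+ 2 / 2)) => a b ab; rewrite PE.
  apply: (@le_trans _ _ (\int[mu]_(x in `[a, b]) (k / 2 * ((2 * pi) ^+ 2 / 2))%:E)%E).
    apply: ge0_le_integral => //.
    - by move=> z _; rewrite lee_fin.
    - by apply/measurable_EFinP/measurable_funTS.
    - by move=> z _; rewrite lee_fin ler_wpM2l ?versine_le// divr_ge0 ?ltW.
  rewrite integral_cst//= lebesgue_measure_itv/= lte_fin.
  case: ifPn => ab'; first by rewrite -EFinD -EFinM.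
  by rewrite mule0 lee_fin mulr_ge0 ?subr_ge0// mulr_ge0 ?divr_ge0 ?sqr_ge0 ?ltW.
have mcos (u : R) : measurable_fun setT (fun z : R => cos (2 * pi * (u * z))).
  by rewrite (_ : (fun z => _) = (fun z => cos (2 * pi * u * z))); [exact: measurable_cosM|apply/funext => z; rewrite mulrA].
have msin (u : R) : measurable_fun setT (fun z : R => sin (2 * pi * (u * z))).
  by rewrite (_ : (fun z => _) = (fun z => sin (2 * pi * u * z))); [exact: measurable_sinM|apply/funext => z; rewrite mulrA].
move=> u; split.
  rewrite (Rintegral_density (M := 1) w0 mw intw PE); last 2 first.
  - exact: mcos.
  - by move=> z; exact: cos_max.
  transitivity (Rintegral mu setT (fun z => k / 4 * (versine (2 * pi * (u + 1)) z) + 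
     (k / 4 * (versine (2 * pi * (u - 1)) z) - k / 2 * versine (2 * pi * u) z))).
    apply: eq_Rintegral => z _; rewrite /w /versine.
    rewrite (_ : 2 * pi * (u + 1) * z = 2 * pi * (u * z) + 2 * pi * z); last by ring.
    rewrite (_ : 2 * pi * (u - 1) * z = 2 * pi * (u * z) - 2 * pi * z); last by ring.
    rewrite (_ : 2 * pi * u * z = 2 * pi * (u * z)); last by ring.
    by rewrite cosD cosB; move: (GRing.inv (z ^+ 2)) => i; field.
  have IZ r a : mu.-integrable setT (EFin \o (fun z => r * versine a z)).
    by have := integrableZl measurableT r (Iv a); apply: eq_integrable => // z _ /=; rewrite EFinM.
  have IB r a r' a' : mu.-integrable setT
      (EFin \o (fun z => r * versine a z - r' * versine a' z)).
    by have := integrableB measurableT (IZ r a) (IZ r' a'); apply: eq_integrable.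
  rewrite RintegralD//.
  rewrite RintegralB// !RintegralZl// !RJ !normrM tentE.
  rewrite (gtr0_norm p0) ger0_norm// /k; move: (pi : R) p0 => y y0; field.
  by rewrite !gt_eqF.
rewrite (Rintegral_density (M := 1) w0 mw intw PE); last 2 first.
- exact: msin.
- by move=> z; exact: sin_max.
set g := fun z => _.
have Ig : mu.-integrable setT (EFin \o g).
  apply: (le_integrable measurableT _ _ (integrableZl measurableT (k / 2) (Iv (2 * pi)))).
    by apply/measurable_EFinP; apply: measurable_funM => //; exact: msin.
  move=> z _; rewrite /= lee_fin normrM -[leRHS]mul1r ler_wpM2r ?normr_ge0//.
  exact: sin_max.
(* The integrand is odd and Lebesgue measure is invariant under reflection. *)
suff : Rintegral mu setT g = - Rintegral mu setT g by lra.
rewrite -mulN1r -RintegralZl//.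
pose pf : {measure set (measurableTypeR R) -> \bar R} :=
  pushforward mu (-%R : measurableTypeR R -> measurableTypeR R).
have mN : measurable_fun [set: measurableTypeR R]
    (-%R : measurableTypeR R -> measurableTypeR R) by exact: oppr_measurable.
transitivity (Rintegral (pf mN) setT g).
  rewrite /Rintegral; congr fine.
  apply: eq_measure_integral => A mA _.
  exact/esym/lebesgue_measureN.
rewrite /Rintegral; congr fine.
have gN z : g (- z) = - g z.
  by rewrite /g /w /versine !mulrN sinN cosN sqrrN mulNr.
rewrite /pf integral_pushforward//.
- by apply: eq_integral => z _ /=; rewrite gN mulN1r.
- exact: (measurable_int mu Ig).
- rewrite preimage_setT; have := integrableZl measurableT (-1) Ig.
  by apply: eq_integrable => // z _ /=; rewrite gN -EFinM mulN1r.
Qed.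

End tent.

(** * Fubini's theorem for bounded functions and finite measures *)

Section bounded_Fubini.
Context d1 d2 (T1 : measurableType d1) (T2 : measurableType d2) (R : realType).
Variables (m1 : {finite_measure set T1 -> \bar R}).
Variables (m2 : {finite_measure set T2 -> \bar R}).
Variables (F : T1 * T2 -> R) (M : R).
Hypotheses (mF : measurable_fun setT F) (FM : forall z, `|F z| <= M).

Lemma bounded_integrable_prod : (m1 \x m2)%E.-integrable setT (EFin \o F).
Proof.
apply: (@measurable_bounded_integrable _ _ _ (m1 \x m2)%E) => //.
  have <- : [set: T1] `*` [set: T2] = [set: T1 * T2] by exact: setXTT.
  have := @product_measure1E _ _ _ _ _ m1 m2 _ _ (@measurableT _ T1) (@measurableT _ T2).
  move=> /= ->; rewrite lte_mul_pinfty//.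
    exact: fin_num_measure.
  exact: fin_num_fun_lty.
exists M; split; first exact: num_real.
by move=> x Mx y _ /=; exact: le_trans (FM y) (ltW Mx).
Qed.

Lemma fubini_FE x : fubini_F m2 (EFin \o F) x =
  (Rintegral m2 setT (fun y => F (x, y)))%:E.
Proof.
rewrite /fubini_F /Rintegral fineK//; apply: integrable_fin_num => //.
apply: (@bounded_integrable _ _ _ _ M) => [|?//].
by apply: measurableT_comp mF _; exact: measurable_pair1.
Qed.

Lemma fubini_GE y : fubini_G m1 (EFin \o F) y =
  (Rintegral m1 setT (fun x => F (x, y)))%:E.
Proof.
rewrite /fubini_G /Rintegral fineK//; apply: integrable_fin_num => //.
apply: (@bounded_integrable _ _ _ _ M) => [|?//].
by apply: measurableT_comp mF _; exact: measurable_pair2.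
Qed.

Lemma measurable_Rintegral_F :
  measurable_fun setT (fun x => Rintegral m2 setT (fun y => F (x, y))).
Proof.
have := measurable_fubini_F bounded_integrable_prod.
have -> : fubini_F m2 (EFin \o F) = EFin \o (fun x => Rintegral m2 setT (fun y => F (x, y))).
  by apply/funext => x; rewrite fubini_FE.
by move=> /measurable_EFinP.
Qed.

Lemma Rintegral_prod1 : Rintegral (m1 \x m2)%E setT F =
  Rintegral m1 setT (fun x => Rintegral m2 setT (fun y => F (x, y))).
Proof.
rewrite [LHS]/Rintegral -(integral12_prod_meas1 bounded_integrable_prod).
rewrite [RHS]/Rintegral; congr fine; apply: eq_integral => x _.
exact: fubini_FE.
Qed.

Lemma Rintegral_Fubini :
  Rintegral m1 setT (fun x => Rintegral m2 setT (fun y => F (x, y))) =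
  Rintegral m2 setT (fun y => Rintegral m1 setT (fun x => F (x, y))).
Proof.
rewrite -Rintegral_prod1 [LHS]/Rintegral.
rewrite -(integral21_prod_meas1 bounded_integrable_prod).
rewrite [RHS]/Rintegral; congr fine; apply: eq_integral => x _.
exact: fubini_GE.
Qed.

End bounded_Fubini.

Lemma measure_probability d (T : measurableType d) (R : realType)
    (m : {measure set T -> \bar R}) : m setT = 1%E ->
  exists Q : probability T R, forall A, Q A = m A.
Proof.
move=> mT; pose f A := m A.
pose mix1 := isMeasure.Build _ _ _ f (measure0 m) (measure_ge0 m)
  (@measure_semi_sigma_additive _ _ _ m).
pose m1 : {measure set T -> \bar R} := HB.pack f mix1.
pose mix2 := @Measure_isProbability.Build _ _ R m1 mT.
pose Q : probability T R := HB.pack f mix1 mix2.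
by exists Q.
Qed.

(** * Products of tents as characteristic functions *)

Section tuples.
Context (R : realType).

Lemma measurable_dotp n (u : n.-tuple R) : measurable_fun setT (@dotp R n u).
Proof.
apply: measurable_sum => i; apply: measurable_funM => //.
exact: measurable_tnth.
Qed.

Lemma measurable_dotp2 n : measurable_fun setT
  (fun z : n.-tuple R * n.-tuple R => dotp z.1 z.2).
Proof.
apply: measurable_sum => i; apply: measurable_funM.
  exact: (measurableT_comp (measurable_tnth i) measurable_fst).
exact: (measurableT_comp (measurable_tnth i) measurable_snd).
Qed.

Lemma measurable_sin_comp d (T : measurableType d) (f : T -> R) :
  measurable_fun setT f -> measurable_fun setT (fun x => sin (f x)).
Proof.
move=> mf; apply: measurableT_comp mf.
by apply: continuous_measurable_fun; exact: continuous_sin.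
Qed.

Lemma measurable_cos_comp d (T : measurableType d) (f : T -> R) :
  measurable_fun setT f -> measurable_fun setT (fun x => cos (f x)).
Proof.
move=> mf; apply: measurableT_comp mf.
by apply: continuous_measurable_fun; exact: continuous_cos.
Qed.

Lemma measurable_box n (a b : n.-tuple R) : measurable (box a b).
Proof.
have -> : box a b = \bigcap_(i in [set: 'I_n]) ((@tnth n R ^~ i) @^-1` `[tnth a i, tnth b i]).
  apply/seteqP; split => x /=.
    by move=> h i _; rewrite /= in_itv/= h.
  by move=> h i; have := h i I; rewrite /= in_itv.
apply: fin_bigcap_measurable => // i _.
by rewrite -[X in measurable X]setTI; apply: measurable_tnth.
Qed.

Definition tupcons n (z : R * n.-tuple R) : n.+1.-tuple R := [tuple of z.1 :: z.2].

Lemma measurable_tupcons n : measurable_fun setT (@tupcons n).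
Proof. exact: measurable_cons. Qed.

Variable P : probability (measurableTypeR R) R.
Variable C : R.
Hypothesis PC : forall a b, a <= b -> (P [set` `[a, b]] <= (C * (b - a))%:E)%E.
Hypothesis Ptent : forall u, 
  Rintegral P setT (fun z => cos (2 * pi * (u * z))) = tent u /\
  Rintegral P setT (fun z => sin (2 * pi * (u * z))) = 0.

(** Induction on the dimension, taking the product with [P] each time. All sine integrals vanish, so
    the addition formulas leave only the product of the cosine integrals, and box bounds
    multiply. *)
Lemma tent_prod_char n : exists2 Q : probability (n.-tuple R) R,
  (forall a b : n.-tuple R, (forall i, tnth a i <= tnth b i) ->
     (Q (box a b) <= (C ^+ n * box_vol a b)%:E)%E) &
  forall u : n.-tuple R,
    Rintegral Q setT (fun z => cos (2 * pi * dotp u z)) = \prod_(i < n) tent (tnth u i) /\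
    Rintegral Q setT (fun z => sin (2 * pi * dotp u z)) = 0.
Proof.
elim: n => [|n [Q QC Qt]].
  exists (dirac [tuple] : probability _ _).
    move=> a b ab; rewrite /box_vol big_ord0 expr0 mulr1.
    exact: probability_le1 (measurable_box a b).
  move=> u; rewrite /Rintegral !integral_dirac//=.
  - by rewrite /dotp !big_ord0 mulr0 cos0 sin0 /dirac !indicE !in_setT !mul1r.
  - by apply/measurable_EFinP/measurable_sin_comp/measurable_funM => //;
      exact: measurable_dotp.
  - by apply/measurable_EFinP/measurable_cos_comp/measurable_funM => //;
      exact: measurable_dotp.
pose pf : {measure set (n.+1.-tuple R) -> \bar R} := pushforward (P \x Q)%E (@tupcons n).
pose m := pf (@measurable_tupcons n).
have mT : m setT = 1%E.
  rewrite /m/= /pushforward preimage_setT -setXTT.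
  transitivity (P setT * Q setT)%E; first exact: product_measure1E.
  by rewrite !probability_setT mule1.
have [Q1 Q1m] := measure_probability mT.
have QE A : Q1 A = (P \x Q)%E (@tupcons n @^-1` A) by rewrite Q1m.
have QI (f : n.+1.-tuple R -> R) : measurable_fun setT f -> (forall x, `|f x| <= 1) ->
    Rintegral Q1 setT f =
    Rintegral P setT (fun x => Rintegral Q setT (fun y => f (tupcons (x, y)))).
  move=> mf f1; rewrite -(@Rintegral_prod1 _ _ _ _ _ P Q (f \o @tupcons n) 1)//; last 2 first.
  - exact: measurableT_comp mf (@measurable_tupcons n).
  - by move=> z; exact: f1.
  rewrite /Rintegral; congr fine.
  rewrite [LHS](_ : _ = \int[m]_x (f x)%:E)%E; last first.
    by apply: eq_measure_integral => A _ _; exact: Q1m.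
  rewrite /m /pf integral_pushforward//.
  - exact: measurable_tupcons.
  - exact/measurable_EFinP.
  - rewrite preimage_setT.
    apply: (@bounded_integrable_prod _ _ _ _ _ P Q (f \o @tupcons n) 1) => [|z]; last exact: f1.
    exact: measurableT_comp mf (@measurable_tupcons n).
exists Q1.
  move=> a b; case/tupleP: a => a0 a; case/tupleP: b => b0 b ab; rewrite QE.
  have -> : @tupcons n @^-1` box [tuple of a0 :: a] [tuple of b0 :: b] =
      [set` `[a0, b0]] `*` box a b.
    apply/seteqP; split => -[x y] /=; rewrite in_itv/=.
      move=> h; split; first by have := h ord0; rewrite !tnth0.
      by move=> i; have := h (lift ord0 i); rewrite !tnthS.
    move=> [h0 h] i; case: (unliftP ord0 i) => [j|] ->; last by rewrite !tnth0.
    by rewrite !tnthS.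
  rewrite product_measure1E//; last exact: measurable_box.
  rewrite /box_vol big_ord_recl !tnth0.
  have -> : C ^+ n.+1 * ((b0 - a0) * \prod_(i < n) (tnth [tuple of b0 :: b] (lift ord0 i) - tnth [tuple of a0 :: a] (lift ord0 i)))
    = (C * (b0 - a0)) * (C ^+ n * box_vol a b).
    rewrite /box_vol exprS.
    under eq_bigr do rewrite !tnthS.
    by ring.
  rewrite EFinM; apply: lee_pmul => //.
    by apply: PC; have := ab ord0; rewrite !tnth0.
  by apply: QC => i; have := ab (lift ord0 i); rewrite !tnthS.
move=> u; case/tupleP: u => u0 u.
have dE x y : dotp [tuple of u0 :: u] (tupcons (x, y)) = u0 * x + dotp u y.
  rewrite /dotp big_ord_recl !tnth0; congr (_ + _).
  by apply: eq_bigr => i _; rewrite !tnthS.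
have [tc ts] := Qt u.
have Icos : Q.-integrable setT (EFin \o (fun y => cos (2 * pi * dotp u y))).
  apply: (@bounded_integrable _ _ _ _ 1) => [|?]; last exact: cos_max.
  by apply/measurable_cos_comp/measurable_funM => //; exact: measurable_dotp.
have Isin : Q.-integrable setT (EFin \o (fun y => sin (2 * pi * dotp u y))).
  apply: (@bounded_integrable _ _ _ _ 1) => [|?]; last exact: sin_max.
  by apply/measurable_sin_comp/measurable_funM => //; exact: measurable_dotp.
have IZ r (f : n.-tuple R -> R) : Q.-integrable setT (EFin \o f) ->
    Q.-integrable setT (EFin \o (fun y => r * f y)).
  by move=> If; have := integrableZl measurableT r If; apply: eq_integrable => // z _ /=; rewrite EFinM.
have PZ r (f : R -> R) : measurable_fun setT f -> (forall x, `|f x| <= 1) ->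
    Rintegral P setT (fun x => f x * r) = Rintegral P setT f * r.
  move=> mf f1; rewrite RintegralZr//.
  exact: (@bounded_integrable _ _ _ _ 1).
have mc : measurable_fun setT (fun x : R => cos (2 * pi * (u0 * x))).
  by apply/measurable_cos_comp/measurable_funM => //; exact: measurable_funM.
have ms : measurable_fun setT (fun x : R => sin (2 * pi * (u0 * x))).
  by apply/measurable_sin_comp/measurable_funM => //; exact: measurable_funM.
split.
  rewrite QI; last 2 first.
  - by apply/measurable_cos_comp/measurable_funM => //; exact: measurable_dotp.
  - by move=> z; exact: cos_max.
  transitivity (Rintegral P setT (fun x => cos (2 * pi * (u0 * x)) * \prod_(i < n) tent (tnth u i))).
    apply: eq_Rintegral => x _.
    under eq_Rintegral do rewrite dE mulrDr cosD.
    rewrite RintegralB//; [|exact: IZ|exact: IZ].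
    by rewrite !RintegralZl// tc ts mulr0 subr0.
  rewrite PZ//; last by move=> x; exact: cos_max.
  rewrite (Ptent u0).1 big_ord_recl tnth0; congr (_ * _).
  by apply: eq_bigr => i _; rewrite tnthS.
rewrite QI; last 2 first.
- by apply/measurable_sin_comp/measurable_funM => //; exact: measurable_dotp.
- by move=> z; exact: sin_max.
transitivity (Rintegral P setT (fun x => sin (2 * pi * (u0 * x)) * \prod_(i < n) tent (tnth u i))).
  apply: eq_Rintegral => x _.
  under eq_Rintegral do rewrite dE mulrDr sinD.
  rewrite RintegralD//; [|exact: IZ|exact: IZ].
  by rewrite !RintegralZl// tc ts mulr0 addr0.
rewrite PZ//; last by move=> x; exact: sin_max.
by rewrite (Ptent u0).2 mul0r.
Qed.
End tuples.

(** * The algebra of bounded measurable functions *)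

Definition bounded_measurable d (T : measurableType d) (R : realType) (f : T -> R) :=
  measurable_fun setT f /\ exists M : R, forall x, `|f x| <= M.

Section bounded_measurable_theory.
Context d (T : measurableType d) (R : realType).
Implicit Types f g : T -> R.

Lemma bm_cst (c : R) : bounded_measurable (fun _ : T => c).
Proof. by split => //; exists `|c|. Qed.

Lemma bmD f g : bounded_measurable f -> bounded_measurable g ->
  bounded_measurable (fun x => f x + g x).
Proof.
move=> [mf [M fM]] [mg [N gN]]; split; first exact: measurable_funD.
by exists (M + N) => x; rewrite (le_trans (ler_normD _ _))// lerD.
Qed.

Lemma bmM f g : bounded_measurable f -> bounded_measurable g ->
  bounded_measurable (fun x => f x * g x).
Proof.
move=> [mf [M fM]] [mg [N gN]]; split; first exact: measurable_funM.
by exists (M * N) => x; rewrite normrM ler_pM.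
Qed.

Lemma bmZ (c : R) f : bounded_measurable f ->
  bounded_measurable (fun x => c * f x).
Proof. by apply: bmM; exact: bm_cst. Qed.

Lemma bmB f g : bounded_measurable f -> bounded_measurable g ->
  bounded_measurable (fun x => f x - g x).
Proof.
move=> [mf [M fM]] [mg [N gN]]; split; first exact: measurable_funB.
by exists (M + N) => x; rewrite (le_trans (ler_normB _ _))// lerD.
Qed.

Lemma bm_sum I (s : seq I) (f : I -> T -> R) :
  (forall i, bounded_measurable (f i)) ->
  bounded_measurable (fun x => \sum_(i <- s) f i x).
Proof.
move=> bf; elim: s => [|i s IH].
  by under eq_fun do rewrite big_nil; exact: bm_cst.
by under eq_fun do rewrite big_cons; exact: bmD.
Qed.

Lemma bm_cos f : measurable_fun setT f -> bounded_measurable (fun x => cos (f x)).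
Proof.
by move=> mf; split; [exact: measurable_cos_comp|exists 1 => x; exact: cos_max].
Qed.

Lemma bm_sin f : measurable_fun setT f -> bounded_measurable (fun x => sin (f x)).
Proof.
by move=> mf; split; [exact: measurable_sin_comp|exists 1 => x; exact: sin_max].
Qed.

Variable m : {finite_measure set T -> \bar R}.

Lemma bm_integrable f : bounded_measurable f -> m.-integrable setT (EFin \o f).
Proof. by move=> [mf [M fM]]; exact: (bounded_integrable m mf fM). Qed.

Lemma bm_RintegralD f g : bounded_measurable f -> bounded_measurable g ->
  Rintegral m setT (fun x => f x + g x) = Rintegral m setT f + Rintegral m setT g.
Proof. by move=> bf bg; rewrite RintegralD//; exact: bm_integrable. Qed.

Lemma bm_RintegralB f g : bounded_measurable f -> bounded_measurable g ->
  Rintegral m setT (fun x => f x - g x) = Rintegral m setT f - Rintegral m setT g.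
Proof. by move=> bf bg; rewrite RintegralB//; exact: bm_integrable. Qed.

Lemma bm_RintegralZ (c : R) f : bounded_measurable f ->
  Rintegral m setT (fun x => c * f x) = c * Rintegral m setT f.
Proof. by move=> bf; rewrite RintegralZl//; exact: bm_integrable. Qed.

Lemma bm_le_Rintegral f g : bounded_measurable f -> bounded_measurable g ->
  (forall x, f x <= g x) -> Rintegral m setT f <= Rintegral m setT g.
Proof.
by move=> bf bg fg; apply: le_Rintegral => //; exact: bm_integrable.
Qed.

Lemma bm_Rintegral_sum I (s : seq I) (f : I -> T -> R) :
  (forall i, bounded_measurable (f i)) ->
  Rintegral m setT (fun x => \sum_(i <- s) f i x) =
  \sum_(i <- s) Rintegral m setT (f i).
Proof.
move=> bf; elim: s => [|i s IH].
  under eq_Rintegral do rewrite big_nil.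
  by rewrite big_nil Rintegral_cst// mul0r.
under eq_Rintegral do rewrite big_cons.
by rewrite big_cons bm_RintegralD ?IH//; exact: bm_sum.
Qed.

(** The quadratic [t ^ 2 * U + 2 * t * h + V] is nonnegative at every point, so its integral is
    nonnegative for all [t]; evaluate at the minimiser. The hypothesis [h ^ 2 <= U * V] suits the
    real part [h] of a product of complex functions with squared moduli [U] and [V]. *)
Lemma Cauchy_Schwarz_Rintegral (h U V : T -> R) :
  bounded_measurable h -> bounded_measurable U -> bounded_measurable V ->
  (forall x, 0 <= U x) -> (forall x, 0 <= V x) -> (forall x, h x ^+ 2 <= U x * V x) ->
  Rintegral m setT h ^+ 2 <= Rintegral m setT U * Rintegral m setT V.
Proof.
move=> bh bU bV U0 V0 hUV.
have quad t : 0 <= t ^+ 2 * Rintegral m setT U + 2 * t * Rintegral m setT h + Rintegral m setT V.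
  rewrite -!bm_RintegralZ// -!bm_RintegralD//; last 3 first.
  - by apply: bmD; exact: bmZ.
  - exact: bmZ.
  - exact: bmZ.
  apply: Rintegral_ge0 => x _.
  have := hUV x; have := U0 x; have := V0 x.
  move: (U x) (V x) (h x) => u v w v0 u0 wuv.
  have [u00|un0] := eqVneq u 0.
    move: wuv; rewrite u00 mul0r => w2.
    have -> : w = 0 by apply/eqP; rewrite -sqrf_eq0 eq_le w2 sqr_ge0.
    by rewrite !mulr0 !add0r.
  have up : 0 < u by rewrite lt_def un0.
  rewrite -(pmulr_rge0 _ up).
  by have := sqr_ge0 (t * u + w); nra.
set a := Rintegral m setT U in quad *; set b := Rintegral m setT V in quad *.
set H := Rintegral m setT h in quad *.
have a0 : 0 <= a by exact: Rintegral_ge0.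
have b0 : 0 <= b by exact: Rintegral_ge0.
have [a00|an0] := eqVneq a 0.
  have [->|H0] := eqVneq H 0; first by rewrite expr2 mul0r mulr_ge0.
  (* With [a = 0] the quadratic is affine, and this [t] gives it the value -1. *)
  have := quad (- (b + 1) / (2 * H)); rewrite a00 mulr0 add0r.
  rewrite (_ : 2 * (- (b + 1) / (2 * H)) * H = - (b + 1)); last by field.
  lra.
have ap : 0 < a by rewrite lt_def an0.
have := quad (- H / a).
rewrite (_ : (- H / a) ^+ 2 * a + 2 * (- H / a) * H + b = (a * b - H ^+ 2) / a); last by field.
by rewrite pmulr_lge0 ?invr_gt0// subr_ge0.
Qed.

End bounded_measurable_theory.

Lemma bm_comp d1 d2 (T1 : measurableType d1) (T2 : measurableType d2)
  (R : realType) (f : T2 -> R) (g : T1 -> T2) :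
  bounded_measurable f -> measurable_fun setT g ->
  bounded_measurable (fun x => f (g x)).
Proof.
by move=> [mf [M fM]] mg; split; [exact: measurableT_comp mf mg|exists M].
Qed.

Lemma bm_Rintegral_F d1 d2 (T1 : measurableType d1) (T2 : measurableType d2)
  (R : realType) (m1 : {finite_measure set T1 -> \bar R})
  (m2 : {finite_measure set T2 -> \bar R}) (F : T1 * T2 -> R) :
  bounded_measurable F ->
  bounded_measurable (fun x => Rintegral m2 setT (fun y => F (x, y))).
Proof.
move=> [mF [M FM]]; split; first exact: (measurable_Rintegral_F m1 m2 mF FM).
exists (M * fine (m2 setT)) => x; apply: Rintegral_le_bound => //.
by apply: measurableT_comp mF _; exact: measurable_pair1.
Qed.

Lemma bm_Fubini d1 d2 (T1 : measurableType d1) (T2 : measurableType d2)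
  (R : realType) (m1 : {finite_measure set T1 -> \bar R})
  (m2 : {finite_measure set T2 -> \bar R}) (F : T1 * T2 -> R) :
  bounded_measurable F ->
  Rintegral m1 setT (fun x => Rintegral m2 setT (fun y => F (x, y))) =
  Rintegral m2 setT (fun y => Rintegral m1 setT (fun x => F (x, y))).
Proof. by move=> [mF [M FM]]; exact: Rintegral_Fubini mF FM. Qed.

(** * Splines and the Fourier transform *)

Section energy.
Context (R : realType) (d : nat).
Notation T := (d.-tuple R).

Definition dilate (s : R) (z : T) : T := [tuple s * tnth z i | i < d].
Definition lattice_point (n : d.-tuple int) : T := [tuple (tnth n i)%:~R | i < d].
Definition hat (s : R) (n : d.-tuple int) (x : T) : R :=
  \prod_(i < d) tent (s * tnth x i - (tnth n i)%:~R).

Lemma measurable_dilate (s : R) : measurable_fun setT (dilate s).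
Proof.
apply/measurable_fun_tnthP => i.
rewrite (_ : _ \o _ = fun z => s * tnth z i); last first.
  by apply/funext => z /=; rewrite tnth_mktuple.
by apply: measurable_funM => //; exact: measurable_tnth.
Qed.

Lemma tent_ge0 (u : R) : 0 <= tent u.
Proof. by rewrite /tent le_max lexx. Qed.

Lemma tent_le1 (u : R) : tent u <= 1.
Proof. by rewrite /tent ge_max ler01/= gerBl. Qed.

Lemma tent_int (n : int) : tent (n%:~R : R) = (n == 0)%:R.
Proof.
rewrite /tent -intr_norm.
have [->|n0] := eqVneq n 0; first by rewrite normr0 subr0 maxEle ler01.
apply/max_idPl; rewrite subr_le0 -[1]/(1%:~R) ler_int.
by rewrite -gtz0_ge1 normr_gt0.
Qed.

Lemma measurable_tent : measurable_fun setT (@tent R).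
Proof.
by apply: measurable_maxr => //; apply: measurable_funB.
Qed.

Lemma hat_ge0 s n x : 0 <= hat s n x.
Proof. by apply: prodr_ge0 => i _; exact: tent_ge0. Qed.

Lemma hat_le1 s n x : hat s n x <= 1.
Proof. by apply: prodr_ile1 => i _; rewrite tent_ge0 tent_le1. Qed.

Lemma bm_hat s n : bounded_measurable (hat s n).
Proof.
split; last by exists 1 => x; rewrite ger0_norm ?hat_ge0 ?hat_le1.
apply: measurable_prod => i _; apply: measurableT_comp measurable_tent _.
apply: measurable_funB => //; apply: measurable_funM => //.
exact: measurable_tnth.
Qed.

Variable Q : probability T R.
Hypothesis Qchar : forall u : T,
  Rintegral Q setT (fun z => cos (2 * pi * dotp u z)) = \prod_(i < d) tent (tnth u i) /\
  Rintegral Q setT (fun z => sin (2 * pi * dotp u z)) = 0.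

Definition energy mu1 mu2 mu3 mu4 (s : R) : R :=
  Rintegral Q setT (fun z => @fourier_abs R d mu1 mu2 mu3 mu4 (dilate s z) ^+ 2).

Lemma measurable_phase (s : R) : measurable_fun setT
  (fun w : T * T => 2 * pi * dotp w.1 (dilate s w.2)).
Proof.
apply: measurable_funM => //.
apply: (measurableT_comp (@measurable_dotp2 R d) (g := fun w : T * T => (w.1, dilate s w.2))).
apply: measurable_fun_pair => //.
exact: measurableT_comp (measurable_dilate s) measurable_snd.
Qed.

Lemma bm_cosint (m : {finite_measure set T -> \bar R}) :
  bounded_measurable (cosint m).
Proof.
apply: (@bm_Rintegral_F _ _ _ _ _ Q m (fun w : T * T => cos (2 * pi * dotp w.2 w.1))).
apply: bm_cos; apply: measurable_funM => //.
exact: measurableT_comp (@measurable_dotp2 R d) (@measurable_swap _ _ _ _).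
Qed.

Lemma bm_sinint (m : {finite_measure set T -> \bar R}) :
  bounded_measurable (sinint m).
Proof.
apply: (@bm_Rintegral_F _ _ _ _ _ Q m (fun w : T * T => sin (2 * pi * dotp w.2 w.1))).
apply: bm_sin; apply: measurable_funM => //.
exact: measurableT_comp (@measurable_dotp2 R d) (@measurable_swap _ _ _ _).
Qed.

Lemma bm_fourier_re mu1 mu2 mu3 mu4 :
  bounded_measurable (@fourier_re R d mu1 mu2 mu3 mu4).
Proof.
by apply: bmD; apply: bmB; (exact: bm_cosint || exact: bm_sinint).
Qed.

Lemma bm_fourier_im mu1 mu2 mu3 mu4 :
  bounded_measurable (@fourier_im R d mu1 mu2 mu3 mu4).
Proof.
by apply: bmB; apply: bmB; (exact: bm_cosint || exact: bm_sinint).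
Qed.

Lemma fourier_abs_sqr mu1 mu2 mu3 mu4 (x : T) :
  @fourier_abs R d mu1 mu2 mu3 mu4 x ^+ 2 =
  fourier_re mu1 mu2 mu3 mu4 x ^+ 2 + fourier_im mu1 mu2 mu3 mu4 x ^+ 2.
Proof. by rewrite sqr_sqrtr// addr_ge0 ?sqr_ge0. Qed.

Lemma bm_fourier_abs mu1 mu2 mu3 mu4 :
  bounded_measurable (@fourier_abs R d mu1 mu2 mu3 mu4).
Proof.
have [mr [M rM]] := bm_fourier_re mu1 mu2 mu3 mu4.
have [mi [N iN]] := bm_fourier_im mu1 mu2 mu3 mu4.
split.
  apply: (measurableT_comp (f := @Num.sqrt R)).
    by apply: continuous_measurable_fun; exact: sqrt_continuous.
  by apply: measurable_funD; exact: measurable_funX.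
exists (M + N) => x.
have M0 : 0 <= M by exact: le_trans (rM x).
have N0 : 0 <= N by exact: le_trans (iN x).
rewrite ger0_norm ?sqrtr_ge0// -[leRHS]ger0_norm ?addr_ge0// -sqrtr_sqr ler_wsqrtr//.
have : fourier_re mu1 mu2 mu3 mu4 x ^+ 2 <= M ^+ 2.
  by rewrite -real_normK ?num_real// lerXn2r ?nnegrE.
have : fourier_im mu1 mu2 mu3 mu4 x ^+ 2 <= N ^+ 2.
  by rewrite -real_normK ?num_real// lerXn2r ?nnegrE.
nra.
Qed.

Lemma dotpBl (u v z : T) :
  dotp [tuple tnth u i - tnth v i | i < d] z = dotp u z - dotp v z.
Proof.
rewrite /dotp -sumrB; apply: eq_bigr => i _.
by rewrite tnth_mktuple mulrBl.
Qed.

Section spline.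
Variables (s : R) (S : seq (d.-tuple int)) (c : d.-tuple int -> R).

Let psi x := \sum_(n <- S) c n * hat s n x.
Let phase x z := 2 * pi * dotp x (dilate s z).
Let freq n z := 2 * pi * dotp (lattice_point n) z.
(** [Dc] and [Ds] are the real and imaginary parts of the trigonometric polynomial with coefficients
    [c n] at the lattice points. *)
Let Dc z := \sum_(n <- S) c n * cos (freq n z).
Let Ds z := \sum_(n <- S) c n * sin (freq n z).

Let measurable_freq n : measurable_fun setT (freq n).
Proof. by apply: measurable_funM => //; exact: measurable_dotp. Qed.

Let bm_Dc : bounded_measurable Dc.
Proof. by apply: bm_sum => n; apply: bmZ; apply: bm_cos. Qed.

Let bm_Ds : bounded_measurable Ds.
Proof. by apply: bm_sum => n; apply: bmZ; apply: bm_sin. Qed.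

Let measurable_phase_x x : measurable_fun setT (phase x).
Proof.
exact: measurableT_comp (measurable_phase s) (measurable_pair1 x).
Qed.

Let phaseB n x : (fun z => 2 * pi * dotp [tuple s * tnth x i - (tnth n i)%:~R | i < d] z) =
  (fun z => phase x z - freq n z).
Proof.
apply/funext => z; rewrite /phase /freq -mulrBr; congr (_ * _).
rewrite /dotp -sumrB; apply: eq_bigr => i _.
by rewrite !tnth_mktuple; ring.
Qed.

Let hatE n x : Rintegral Q setT (fun z => cos (phase x z - freq n z)) = hat s n x.
Proof.
have := (Qchar [tuple s * tnth x i - (tnth n i)%:~R | i < d]).1.
under eq_Rintegral => z _ do rewrite (congr1 (@^~ z) (phaseB n x)).
move=> ->; apply: eq_bigr => i _; by rewrite tnth_mktuple.
Qed.

Let sinhatE n x : Rintegral Q setT (fun z => sin (phase x z - freq n z)) = 0.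
Proof.
have := (Qchar [tuple s * tnth x i - (tnth n i)%:~R | i < d]).2.
by under eq_Rintegral => z _ do rewrite (congr1 (@^~ z) (phaseB n x)).
Qed.

Let bm_phaseB_cos n x : bounded_measurable (fun z => cos (phase x z - freq n z)).
Proof. by apply: bm_cos; exact: measurable_funB. Qed.

Let bm_phaseB_sin n x : bounded_measurable (fun z => sin (phase x z - freq n z)).
Proof. by apply: bm_sin; exact: measurable_funB. Qed.

(** Each hat is the characteristic function of [Q] at [s x - n], so the spline is a [Q]-average of
    plane waves in [x]; integrating it against a measure will produce the Fourier transform. *)
Let psiA x : psi x =
  Rintegral Q setT (fun z => Dc z * cos (phase x z) + Ds z * sin (phase x z)).
Proof.
transitivity (Rintegral Q setT (fun z => \sum_(n <- S) c n * cos (phase x z - freq n z))).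
  rewrite bm_Rintegral_sum => [|n]; last by apply: bmZ.
  by apply: eq_bigr => n _; rewrite bm_RintegralZ// hatE.
apply: eq_Rintegral => z _; rewrite /Dc /Ds !mulr_suml -big_split/=.
by apply: eq_bigr => n _; rewrite cosB; ring.
Qed.

(* The sine transform of Q vanishes, which lets the imaginary part of the measure
   enter at no cost. *)
Let psiB x : 0 =
  Rintegral Q setT (fun z => Ds z * cos (phase x z) - Dc z * sin (phase x z)).
Proof.
transitivity (Rintegral Q setT (fun z => \sum_(n <- S) (- c n) * sin (phase x z - freq n z))).
  rewrite bm_Rintegral_sum => [|n]; last by apply: bmZ.
  by rewrite big1// => n _; rewrite bm_RintegralZ// sinhatE mulr0.
apply: eq_Rintegral => z _; rewrite /Dc /Ds !mulr_suml -sumrB.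
by apply: eq_bigr => n _; rewrite sinB; ring.
Qed.

Let bm_cosphase : bounded_measurable (fun w : T * T => cos (phase w.1 w.2)).
Proof. by apply: bm_cos; exact: measurable_phase. Qed.

Let bm_sinphase : bounded_measurable (fun w : T * T => sin (phase w.1 w.2)).
Proof. by apply: bm_sin; exact: measurable_phase. Qed.

Let bm_snd (f : T -> R) : bounded_measurable f ->
  bounded_measurable (fun w : T * T => f w.2).
Proof. by move=> bf; exact: bm_comp bf measurable_snd. Qed.

Let measurable_phase_z z : measurable_fun setT (phase ^~ z).
Proof.
exact: measurableT_comp (measurable_phase s) (measurable_pair2 z).
Qed.

Let Rintegral_psi (m : {finite_measure set T -> \bar R}) : Rintegral m setT psi =
  Rintegral Q setT (fun z => Dc z * cosint m (dilate s z) + Ds z * sinint m (dilate s z)).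
Proof.
transitivity (Rintegral m setT (fun x => Rintegral Q setT
    (fun z => Dc z * cos (phase x z) + Ds z * sin (phase x z)))).
  by apply: eq_Rintegral => x _; exact: psiA.
rewrite (@bm_Fubini _ _ _ _ _ m Q (fun w : T * T => Dc w.2 * cos (phase w.1 w.2) + Ds w.2 * sin (phase w.1 w.2))).
  apply: eq_Rintegral => z _ /=.
  have bc : bounded_measurable (fun x => cos (phase x z)) by exact: bm_cos.
  have bs : bounded_measurable (fun x => sin (phase x z)) by exact: bm_sin.
  rewrite bm_RintegralD; [|exact: bmZ|exact: bmZ].
  by rewrite !bm_RintegralZ.
by apply: bmD; apply: bmM => //; exact: bm_snd.
Qed.

Let Rintegral_conj (m : {finite_measure set T -> \bar R}) : 0 =
  Rintegral Q setT (fun z => Ds z * cosint m (dilate s z) - Dc z * sinint m (dilate s z)).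
Proof.
transitivity (Rintegral m setT (fun _ => 0 : R)).
  by rewrite Rintegral_cst// mul0r.
transitivity (Rintegral m setT (fun x => Rintegral Q setT
    (fun z => Ds z * cos (phase x z) - Dc z * sin (phase x z)))).
  by apply: eq_Rintegral => x _; exact: psiB.
rewrite (@bm_Fubini _ _ _ _ _ m Q (fun w : T * T => Ds w.2 * cos (phase w.1 w.2) - Dc w.2 * sin (phase w.1 w.2))).
  apply: eq_Rintegral => z _ /=.
  have bc : bounded_measurable (fun x => cos (phase x z)) by exact: bm_cos.
  have bs : bounded_measurable (fun x => sin (phase x z)) by exact: bm_sin.
  rewrite bm_RintegralB; [|exact: bmZ|exact: bmZ].
  by rewrite !bm_RintegralZ.
by apply: bmB; apply: bmM => //; exact: bm_snd.
Qed.

Let orthogonality : uniq S ->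
  Rintegral Q setT (fun z => Dc z ^+ 2 + Ds z ^+ 2) = \sum_(n <- S) c n ^+ 2.
Proof.
move=> uS.
have bfr n n' : bounded_measurable (fun z => cos (freq n z - freq n' z)).
  by apply: bm_cos; exact: measurable_funB.
transitivity (Rintegral Q setT (fun z =>
    \sum_(n <- S) \sum_(n' <- S) (c n * c n') * cos (freq n z - freq n' z))).
  apply: eq_Rintegral => z _; rewrite !expr2 /Dc /Ds !big_distrlr -big_split/=.
  apply: eq_bigr => n _; rewrite -big_split/=; apply: eq_bigr => n' _.
  by rewrite cosB; ring.
rewrite bm_Rintegral_sum => [|n]; last by apply: bm_sum => n'; exact: bmZ.
rewrite big_seq [RHS]big_seq; apply: eq_bigr => n nS.
rewrite bm_Rintegral_sum => [|n']; last exact: bmZ.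
rewrite (bigD1_seq n)//= big1_seq => [|n' /andP[n'n _]].
  rewrite bm_RintegralZ// addr0 -expr2.
  under eq_Rintegral do rewrite subrr cos0.
  transitivity (c n ^+ 2 * (1 * fine (Q setT))).
    by congr (_ * _); exact: Rintegral_cst.
  by rewrite probability_setT mul1r mulr1.
rewrite bm_RintegralZ//.
have -> : (fun z => cos (freq n z - freq n' z)) = (fun z => cos (2 * pi *
   dotp [tuple tnth (lattice_point n) i - tnth (lattice_point n') i | i < d] z)).
  by apply/funext => z; rewrite dotpBl mulrBr.
rewrite (Qchar _).1.
have [i ni] : exists i, tnth n i != tnth n' i.
  apply/existsP; apply: contraNT n'n; rewrite negb_exists => /forallP h.
  by apply/eqP/eq_from_tnth => i; have := h i; rewrite negbK => /eqP.
rewrite (bigD1 i)//= !tnth_mktuple -intrB tent_int subr_eq0 (negbTE ni).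
by rewrite mul0r mulr0.
Qed.

Lemma energy_bound (mu1 mu2 mu3 mu4 : {finite_measure set T -> \bar R}) :
  uniq S ->
  (Rintegral mu1 setT psi - Rintegral mu2 setT psi) ^+ 2 <=
  (\sum_(n <- S) c n ^+ 2) * energy mu1 mu2 mu3 mu4 s.
Proof.
move=> uS.
have bC m : bounded_measurable (fun z => cosint m (dilate s z)).
  by apply: bm_comp (measurable_dilate s); exact: bm_cosint.
have bS m : bounded_measurable (fun z => sinint m (dilate s z)).
  by apply: bm_comp (measurable_dilate s); exact: bm_sinint.
have bre := bm_comp (bm_fourier_re mu1 mu2 mu3 mu4) (measurable_dilate s).
have bim := bm_comp (bm_fourier_im mu1 mu2 mu3 mu4) (measurable_dilate s).
pose re z := fourier_re mu1 mu2 mu3 mu4 (dilate s z).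
pose im z := fourier_im mu1 mu2 mu3 mu4 (dilate s z).
(* Subtracting the vanishing integrals for [mu3] and [mu4] completes the transforms of [mu1] and
   [mu2] to the real and imaginary parts of the whole transform. *)
have -> : Rintegral mu1 setT psi - Rintegral mu2 setT psi =
    Rintegral Q setT (fun z => Dc z * re z - Ds z * im z).
  have := Rintegral_conj mu3; have := Rintegral_conj mu4.
  rewrite !Rintegral_psi => e4 e3.
  set A1 := Rintegral Q setT _; set A2 := Rintegral Q setT _.
  transitivity ((A1 - A2) - (0 - 0)); first by rewrite !subr0.
  rewrite {1}e3 e4 /A1 /A2 -!bm_RintegralB; try by do ?[apply: bmB|apply: bmD|apply: bmM].
  apply: eq_Rintegral => z _; rewrite /re /im /fourier_re /fourier_im; ring.
rewrite -orthogonality// /energy.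
apply: Cauchy_Schwarz_Rintegral.
- by apply: bmB; apply: bmM.
- by under eq_fun do rewrite !expr2; apply: bmD; apply: bmM.
- apply: (bm_comp (f := fun x => fourier_abs mu1 mu2 mu3 mu4 x ^+ 2) _ (measurable_dilate s)).
  by under eq_fun do rewrite expr2; apply: bmM; exact: bm_fourier_abs.
- by move=> z; rewrite addr_ge0 ?sqr_ge0.
- by move=> z; exact: sqr_ge0.
- move=> z; rewrite fourier_abs_sqr -/(re z) -/(im z).
  (* This square is the defect in Lagrange's identity for
     [(Dc ^ 2 + Ds ^ 2) * (re ^ 2 + im ^ 2)]. *)
  have := sqr_ge0 (Dc z * im z + Ds z * re z); nra.
Qed.

End spline.
End energy.

(** * Rearrangement of the Fourier transform *)

Section outer.
Context (R : realType) (d : nat).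
Notation T := (d.-tuple R).

Lemma box_vol_ge0 (a b : T) : (forall i, tnth a i <= tnth b i) -> 0 <= box_vol a b.
Proof. by move=> ab; apply: prodr_ge0 => i _; rewrite subr_ge0. Qed.

Lemma dilate_box (s : R) (a b : T) : 0 < s ->
  dilate s @^-1` box a b = box (dilate s^-1 a) (dilate s^-1 b).
Proof.
move=> s0; apply/seteqP; split => z /= h i; have := h i;
  by rewrite !tnth_mktuple ler_pdivrMl// ler_pdivlMl.
Qed.

Lemma box_vol_dilate (s : R) (a b : T) :
  box_vol (dilate s a) (dilate s b) = s ^+ d * box_vol a b.
Proof.
rewrite /box_vol -[in s ^+ d](card_ord d) -prodr_const -big_split/=.
by apply: eq_bigr => i _; rewrite !tnth_mktuple mulrBr.
Qed.

Lemma lebesgue_outer_ge0 (E : set T) : (0 <= lebesgue_outer E)%E.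
Proof.
apply: le_ereal_inf_tmp => _ [a [b [ab [_ ->]]]].
by apply: nneseries_ge0 => k _ _; rewrite lee_fin box_vol_ge0.
Qed.

Lemma le_lebesgue_outer (E F : set T) : E `<=` F ->
  (lebesgue_outer E <= lebesgue_outer F)%E.
Proof.
move=> EF; apply: le_ereal_inf_tmp => _ [a [b [ab [Fab ->]]]].
apply: ereal_inf_lbound; exists a, b; split => //; split => //.
exact: subset_trans EF Fab.
Qed.

(** A degenerate box has volume 0 only in positive dimension: for [d = 0] the empty product is 1. *)
Lemma lebesgue_outer0 : (0 < d)%N -> lebesgue_outer (set0 : set T) = 0%E.
Proof.
move=> d0; apply/eqP; rewrite eq_le lebesgue_outer_ge0 andbT.
apply: ereal_inf_lbound.
pose a : nat -> T := fun _ => [tuple 0 | i < d].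
exists a, a; split => //; split => //.
rewrite eseries0// => k _ _; rewrite /box_vol.
by rewrite (bigD1 (Ordinal d0))//= subrr mul0r.
Qed.

Variable Q : probability T R.
Variable D : R.
Hypothesis D0 : 0 < D.
Hypothesis Qbox : forall a b : T, (forall i, tnth a i <= tnth b i) ->
  (Q (box a b) <= (D * box_vol a b)%:E)%E.

(** Subadditivity of [Q] and the bound on boxes apply to each cover by boxes, so [lebesgue_outer]
    never has to be identified with a measure. *)
Lemma probability_dilate_outer (s : R) (E : set T) : 0 < s -> measurable E ->
  (Q (dilate s @^-1` E) <= (D / s ^+ d)%:E * lebesgue_outer E)%E.
Proof.
move=> s0 mE.
have c0 : 0 < D / s ^+ d by rewrite divr_gt0// exprn_gt0.
rewrite -lee_pdivrMl//.
apply: le_ereal_inf_tmp => _ [a [b [ab [Eab ->]]]].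
rewrite lee_pdivrMl// -nneseriesZl; last first.
  by move=> i _; rewrite lee_fin box_vol_ge0.
have mpre (A : set T) : measurable A -> measurable (dilate s @^-1` A).
  by move=> mA; rewrite -[X in measurable X]setTI; exact: measurable_dilate.
apply: (@le_trans _ _ (\sum_(k <oo) Q (dilate s @^-1` box (a k) (b k)))%E).
  apply: (@measure_sigma_subadditive _ _ _ Q _ (fun k => dilate s @^-1` box (a k) (b k))).
  - by move=> k; apply: mpre; exact: measurable_box.
  - exact: mpre.
  - by rewrite -preimage_bigcup; exact: preimage_subset.
apply: lee_nneseries => // k _.
rewrite dilate_box// (le_trans (Qbox _))//.
  by move=> i; rewrite !tnth_mktuple ler_wpM2l// invr_ge0 ltW.
by rewrite box_vol_dilate -EFinM lee_fin exprVn mulrA.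
Qed.

Section rearrangement.
Hypothesis d0 : (0 < d)%N.
Variables (f : T -> R) (M : R).
Hypotheses (mf : measurable_fun setT f) (f0 : forall x, 0 <= f x)
  (fM : forall x, f x <= M).

(** The nonincreasing rearrangement of [f], as generalised inverse of its distribution function. *)
Definition rearr (l : R) : R := inf [set t | 0 <= t /\ (distrib f t <= l%:E)%E].

Lemma le_distrib (t u : R) : t <= u -> (distrib f u <= distrib f t)%E.
Proof. by move=> tu; apply: le_lebesgue_outer => x /=; exact: le_trans. Qed.

Lemma rearr_nonempty (l : R) : 0 <= l ->
  [set t | 0 <= t /\ (distrib f t <= l%:E)%E] !=set0.
Proof.
move=> l0; exists (`|M| + 1) => /=; split; first by rewrite addr_ge0.
rewrite /distrib (_ : [set x | _] = set0) ?lebesgue_outer0 ?lee_fin//.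
apply/seteqP; split => // x /=; rewrite (ger0_norm (f0 x)) => h.
by have := le_trans h (fM x); have := ler_norm M; lra.
Qed.

Lemma rearr_ge0 (l : R) : 0 <= l -> 0 <= rearr l.
Proof.
by move=> l0; apply: lb_le_inf (rearr_nonempty l0) _ => t [].
Qed.

Lemma gt_rearr (l t : R) : 0 <= l -> rearr l < t -> (distrib f t <= l%:E)%E.
Proof.
move=> l0 /(inf_lt (rearr_nonempty l0))[u [u0 ul] ut].
exact: le_trans (le_distrib (ltW ut)) ul.
Qed.

Lemma lt_rearr (l t : R) : 0 <= l -> 0 <= t -> t < rearr l ->
  (l%:E < distrib f t)%E.
Proof.
move=> l0 t0; rewrite !ltNge; apply: contra => tl.
by apply: ge_inf => //; exists 0 => ? [].
Qed.

Lemma measurable_superlevel (t : R) : measurable [set x | t <= f x].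
Proof.
rewrite -[X in measurable X]setTI.
have -> : [set x | t <= f x] = f @^-1` `[t, +oo[.
  by apply/seteqP; split => x /=; rewrite in_itv/= andbT.
exact: mf.
Qed.

Lemma measurable_strict_superlevel (t : R) : measurable [set x | t < f x].
Proof.
rewrite -[X in measurable X]setTI.
have -> : [set x | t < f x] = f @^-1` `]t, +oo[.
  by apply/seteqP; split => x /=; rewrite in_itv/= andbT.
exact: mf.
Qed.

(** The distribution function is controlled only strictly above [rearr l]; the strict superlevel set
    is therefore exhausted by the superlevel sets at [rearr l + 1 / (n + 1)]. *)
Lemma probability_rearr (s l : R) : 0 < s -> 0 <= l ->
  (Q [set z | (rearr l < f (dilate s z))%R] <= (D / s ^+ d * l)%:E)%E.
Proof.
move=> s0 l0.
have c0 : 0 < D / s ^+ d by rewrite divr_gt0// exprn_gt0.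
pose F n := dilate s @^-1` [set x | rearr l + n.+1%:R^-1 <= f x].
have mF n : measurable (F n).
  rewrite -[X in measurable X]setTI; apply: measurable_dilate => //.
  exact: measurable_superlevel.
have -> : [set z | rearr l < f (dilate s z)] = \bigcup_n F n.
  apply/seteqP; split => z /=.
    move=> h; have [n hn] := ltr_add_invr h.
    by exists n => //; exact: ltW.
  by move=> [n _] /=; apply: lt_le_trans; rewrite ltrDl invr_gt0.
have ndF : {homo F : n m / (n <= m)%N >-> (n <= m)%O}.
  move=> n m nm; apply/subsetPset => z /=; apply: le_trans.
  by rewrite lerD2l lef_pV2 ?posrE// ler_nat.
have cvF := nondecreasing_cvg_mu (mu := Q) mF (bigcup_measurable (fun n _ => mF n)) ndF.
rewrite -(cvg_lim _ cvF)//; apply: lime_le; first by apply/cvg_ex; eexists; exact: cvF.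
apply: nearW => n /=.
rewrite (le_trans (probability_dilate_outer s0 (measurable_superlevel _)))//.
rewrite [leRHS]EFinM lee_wpmul2l ?lee_fin ?(ltW c0)//.
have := @gt_rearr l (rearr l + n.+1%:R^-1) l0.
rewrite ltrDl invr_gt0 ltr0Sn => /(_ isT); rewrite /distrib.
apply: le_trans; apply: le_lebesgue_outer => x /=.
by rewrite ger0_norm.
Qed.

(* Layer-cake with the levels [rearr (l i)], truncated after [I] layers. *)
Lemma layer_bound (g : nat -> R) (t : R) (I : nat) : 0 <= t <= M -> 
  t ^+ 2 <= g 0%N ^+ 2 + \sum_(i < I) g i.+1 ^+ 2 * (g i < t)%R%:R + M ^+ 2 * (g I < t)%R%:R.
Proof.
move=> /andP[t0 tM].
suff h : t ^+ 2 <= g 0%N ^+ 2 + \sum_(i < I) g i.+1 ^+ 2 * (g i < t)%R%:R + t ^+ 2 * (g I < t)%R%:R.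
  apply: (le_trans h); rewrite lerD2l ler_wpM2r// lerXn2r ?nnegrE//.
  exact: le_trans tM.
elim: I => [|I IH].
  rewrite big_ord0 addr0; case: (ltP (g 0%N) t) => gt.
    by rewrite mulr1 lerDr sqr_ge0.
  by rewrite mulr0 addr0 lerXn2r ?nnegrE// (le_trans t0).
apply: (le_trans IH); rewrite big_ord_recr/= -!addrA !lerD2l.
case: (ltP (g I) t) => gt; last first.
  by rewrite !mulr0 add0r mulr_ge0 ?sqr_ge0.
rewrite !mulr1; case: (ltP (g I.+1) t) => gt1.
  by rewrite mulr1 lerDr sqr_ge0.
by rewrite mulr0 addr0 lerXn2r ?nnegrE// (le_trans t0).
Qed.

(** The last term keeps the sum finite: beyond [I] layers only [f <= M] is used, on a set whose mass
    is small with [l I]. *)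
Lemma Rintegral_rearr (s : R) (l : nat -> R) (I : nat) : 0 < s -> (forall i, 0 <= l i) ->
  Rintegral Q setT (fun z => f (dilate s z) ^+ 2) <=
  rearr (l 0%N) ^+ 2 + \sum_(i < I) rearr (l i.+1) ^+ 2 * (D / s ^+ d * l i)
  + M ^+ 2 * (D / s ^+ d * l I).
Proof.
move=> s0 l0.
have M0 : 0 <= M by exact: le_trans (f0 [tuple 0 | i < d]) (fM _).
pose A i := [set z | rearr (l i) < f (dilate s z)].
have mA i : measurable (A i).
  have := measurable_dilate s measurableT (measurable_strict_superlevel (rearr (l i))).
  by rewrite setTI.
have bI i : bounded_measurable (\1_(A i) : T -> R).
  split; first exact: measurable_indic.
  by exists 1 => x; rewrite indicE; case: (_ \in _); rewrite ?normr1 ?normr0.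
have RI i : Rintegral Q setT (\1_(A i) : T -> R) <= D / s ^+ d * l i.
  rewrite /Rintegral integral_indic// setIT.
  rewrite -lee_fin fineK; first exact: probability_rearr.
  exact: fin_num_measure.
have bf : bounded_measurable f by split => //; exists M => x; rewrite ger0_norm.
have bs : bounded_measurable (fun z => \sum_(i < I) rearr (l i.+1) ^+ 2 * \1_(A i) z).
  by apply: bm_sum => i; exact: bmZ.
apply: (@le_trans _ _ (Rintegral Q setT (fun z => rearr (l 0%N) ^+ 2 +
   \sum_(i < I) rearr (l i.+1) ^+ 2 * \1_(A i) z + M ^+ 2 * \1_(A I) z))).
  apply: bm_le_Rintegral.
  - apply: (bm_comp (f := fun x => f x ^+ 2) _ (measurable_dilate s)).
    by under eq_fun do rewrite expr2; exact: bmM.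
  - by apply: bmD; [apply: bmD => //; exact: bm_cst|exact: bmZ].
  - move=> z; rewrite (le_trans (layer_bound (fun i => rearr (l i)) I _))//.
      by rewrite f0 fM.
    have e i : \1_(A i) z = (rearr (l i) < f (dilate s z))%R%:R :> R.
      rewrite indicE; congr (_%:R); congr nat_of_bool; apply/idP/idP; rewrite inE//.
    by rewrite e; under [in leRHS]eq_bigr do rewrite e.
rewrite bm_RintegralD; [|by apply: bmD => //; exact: bm_cst|exact: bmZ].
rewrite bm_RintegralD//; last exact: bm_cst.
rewrite bm_Rintegral_sum => [|i]; last exact: bmZ.
rewrite bm_RintegralZ//.
apply: lerD; last by rewrite ler_wpM2l ?sqr_ge0.
apply: lerD.
  rewrite (_ : Rintegral _ _ _ = rearr (l 0%N) ^+ 2 * fine (Q setT)); last exact: Rintegral_cst.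
  by rewrite probability_setT mulr1.
by apply: ler_sum => i _; rewrite bm_RintegralZ// ler_wpM2l ?sqr_ge0.
Qed.

End rearrangement.
End outer.

(** The integral of a nonnegative function is a supremum over the simple functions below it, so
    neither function has to be measurable. This is meant for the Lorentz integrand, which is built
    from an outer measure. *)
Lemma ge0_le_integral_nomeas d (T : measurableType d) (R : realType)
    (m : {measure set T -> \bar R}) (D : set T) (f g : T -> \bar R) :
  (forall x, D x -> 0 <= f x)%E -> (forall x, D x -> f x <= g x)%E ->
  (\int[m]_(x in D) f x <= \int[m]_(x in D) g x)%E.
Proof.
move=> f0 fg.
have g0 x : D x -> (0 <= g x)%E by move=> Dx; exact: le_trans (f0 _ Dx) (fg _ Dx).
rewrite !ge0_integralE//; apply: le_ereal_sup => _ [h hf <-]; exists h => // x.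
apply: (le_trans (hf x)); rewrite !patchE; case: ifPn => // /set_mem; exact: fg.
Qed.

Lemma ler_sum_uniq_sub (R : realType) (I : eqType) (s s' : seq I) (f : I -> R) :
  uniq s -> uniq s' -> {subset s <= s'} -> (forall i, 0 <= f i) ->
  \sum_(i <- s) f i <= \sum_(i <- s') f i.
Proof.
move=> us us' ss' f0.
rewrite (perm_big [seq i <- s' | i \in s])/=.
  rewrite big_filter big_mkcond/=; apply: ler_sum => i _.
  by case: ifP.
apply: uniq_perm => //; first exact: filter_uniq.
by move=> i; rewrite mem_filter; case: (boolP (i \in s)) => //= /ss' ->.
Qed.

Lemma seq_int_max (s : seq int) : s != [::] ->
  exists2 L, L \in s & forall l, l \in s -> l <= L.
Proof.
elim: s => // a s IH _; have [->|/IH[L Ls hL]] := eqVneq s [::].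
  by exists a; rewrite ?mem_head// => l; rewrite inE => /eqP ->.
have [aL|La] := leP a L.
  by exists L; rewrite ?inE ?Ls ?orbT// => l; rewrite inE => /predU1P[->//|/hL].
exists a; rewrite ?mem_head// => l; rewrite inE => /predU1P[->//|/hL lL].
exact: le_trans lL (ltW La).
Qed.

Lemma geometric_sum_le (R : realType) (t : R) (n : nat) : 0 <= t -> t < 1 ->
  \sum_(i < n) t ^+ i <= (1 - t)^-1.
Proof.
move=> t0 t1.
have t1' : 0 < 1 - t by rewrite subr_gt0.
rewrite -[leRHS]mul1r ler_pdivlMr// mulrC -opprB mulNr -subrX1 opprB.
by rewrite gerBl exprn_ge0.
Qed.

(** * Real powers of two and geometric sums *)

Section powers_of_two.
Context (R : realType).
Definition pow2 (x : R) : R := 2 `^ x.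

Lemma pow2_gt0 x : 0 < pow2 x. Proof. by rewrite powR_gt0. Qed.
Lemma pow2_ge0 x : 0 <= pow2 x. Proof. by rewrite powR_ge0. Qed.
Lemma pow2_neq0 x : pow2 x != 0. Proof. by rewrite gt_eqF// pow2_gt0. Qed.
Lemma pow2D x y : pow2 (x + y) = pow2 x * pow2 y.
Proof. by rewrite /pow2 powRD// pnatr_eq0 implybT. Qed.
Lemma pow2N x : pow2 (- x) = (pow2 x)^-1. Proof. exact: powRN. Qed.
Lemma pow2_0 : pow2 0 = 1. Proof. exact: powRr0. Qed.
Lemma pow2M x y : pow2 x `^ y = pow2 (x * y).
Proof. by rewrite /pow2 powRrM. Qed.
Lemma ler_pow2 x y : (pow2 x <= pow2 y) = (x <= y).
Proof.
rewrite /pow2 /powR pnatr_eq0/= ler_expR ler_pM2r// ln_gt0//.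
by rewrite ltr1n.
Qed.
Lemma ltr_pow2 x y : (pow2 x < pow2 y) = (x < y).
Proof. by rewrite !ltNge ler_pow2. Qed.
Lemma pow2_lt1 x : (pow2 x < 1) = (x < 0).
Proof. by rewrite -[X in _ < X]pow2_0 ltr_pow2. Qed.
Lemma pow2X x (n : nat) : pow2 x ^+ n = pow2 (x * n%:R).
Proof. by rewrite -pow2M powR_mulrn// pow2_ge0. Qed.
Lemma pow2_int (k : int) : pow2 k%:~R = 2 ^ k.
Proof. by rewrite /pow2 powR_intmul. Qed.
End powers_of_two.

(* The powers [pow2 (a * l)] with [l] in [s] are dominated by a geometric series
   ending at the largest of them. *)
Lemma sum_pow2_le (R : realType) (a B : R) (s : seq int) : 0 < a -> uniq s ->
  (forall l, l \in s -> pow2 (a * l%:~R) <= B) -> 0 <= B ->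
  \sum_(l <- s) pow2 (a * l%:~R) <= B / (1 - pow2 (- a)).
Proof.
move=> a0 us sB B0.
have t1 : pow2 (- a) < 1 by rewrite pow2_lt1 oppr_lt0.
have t1' : 0 < 1 - pow2 (- a) by rewrite subr_gt0.
have [->|sn] := eqVneq s [::].
  by rewrite big_nil divr_ge0// ltW.
have [L Ls hL] := seq_int_max sn.
(* [N] bounds every gap [L - l], so [s] is contained in the run [L, L - 1, ..., L - N]. *)
pose N := (\sum_(l <- s) `|L - l|)%N.
pose s' := [seq L - (i%:Z) | i <- iota 0 N.+1].
have us' : uniq s'.
  rewrite map_inj_uniq ?iota_uniq// => i j.
  by move/addrI/oppr_inj => [].
have ss' : {subset s <= s'}.
  move=> l ls; apply/mapP; exists `|L - l|%N.
    rewrite mem_iota add0n ltnS /N (big_rem l)//= leq_addr//.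
  by rewrite gez0_abs ?subr_ge0 ?hL// opprB addrC subrK.
apply: (le_trans (ler_sum_uniq_sub us us' ss' _)) => [l|]; first exact: pow2_ge0.
rewrite big_map -[iota 0 N.+1]/(index_iota 0 N.+1) big_mkord.
apply: (@le_trans _ _ (\sum_(i < N.+1) B * pow2 (- a) ^+ i)).
  apply: ler_sum => i _; rewrite intrB mulrBr pow2D.
  by rewrite pow2X mulNr ler_wpM2r ?pow2_ge0// sB.
by rewrite -mulr_sumr ler_wpM2l// geometric_sum_le// pow2_ge0.
Qed.

(** * The Lorentz condition as an l^q bound *)

Section lorentz_sequence.
Context (R : realType) (d : nat) (p q : R).
Notation T := (d.-tuple R).
Hypotheses (d0 : (0 < d)%N) (p2 : 2 < p) (q1 : 1 <= q).
Variables (f : T -> R) (M : R).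
Hypotheses (f0 : forall x, 0 <= f x) (fM : forall x, f x <= M).
Hypothesis fpq : in_lorentz f p q.

(** Samples of [u ^ (1 / p) * rearr f u] at [u = 2 ^ (l d)]: the discrete form of the Lorentz
    quasi-norm. *)
Definition rearr_seq (l : int) : R :=
  pow2 (l%:~R * d%:R / p) * rearr f (pow2 (l%:~R * d%:R)).

Lemma rearr_seq_ge0 l : 0 <= rearr_seq l.
Proof.
by rewrite mulr_ge0 ?pow2_ge0// (rearr_ge0 d0 f0 fM)// pow2_ge0.
Qed.

(** Put [g l = rearr f (2 ^ (l d))]. For [t] in [J l = ]g l / 2, g l[] the distribution function
    exceeds [2 ^ (l d)]. Any number of these intervals may overlap, but the powers [2 ^ (a l)] over
    all [l] with [t] in [J l] are part of a geometric series, controlled by a bound on its largest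
    term, here [distrib f t ^ (q / p)]. A weighted sum of the indicators of the [J l] is thus below
    the Lorentz integrand. *)
Lemma rearr_seq_summable : exists2 B : R, 0 <= B & forall s : seq int, uniq s ->
  \sum_(l <- s) rearr_seq l `^ q <= B.
Proof.
have p0 : 0 < p by exact: lt_trans p2.
have q0 : 0 < q by exact: lt_le_trans q1.
have dR : 0 < d%:R :> R by rewrite ltr0n.
pose a := d%:R * q / p.
have a0 : 0 < a by rewrite divr_gt0// mulr_gt0.
have [C C0 hC] : exists2 C : R, 0 < C & forall (s : seq int) (B : R), uniq s ->
    (forall l, l \in s -> pow2 (a * l%:~R) <= B) -> 0 <= B ->
    \sum_(l <- s) pow2 (a * l%:~R) <= C * B.
  exists (1 - pow2 (- a))^-1.
    by rewrite invr_gt0 subr_gt0 pow2_lt1 oppr_lt0.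
  by move=> s B us sB B0; rewrite mulrC sum_pow2_le.
pose F t := (poweR (distrib f t * (t `^ p)%:E) (q / p) * (t^-1)%:E)%E.
pose I := (\int[@lebesgue_measure R]_(t in [set t : R | (0 < t)%R]) F t)%E.
have I0 : (0 <= I)%E.
  apply: integral_ge0 => t /= t0; rewrite mule_ge0 ?poweR_ge0//.
  by rewrite lee_fin invr_ge0 ltW.
have Ioo : (I < +oo)%E.
  have := fpq; rewrite /in_lorentz /lorentz_pow -/I.
  by move: I0; case: (I) => [r _ _|_|//]; [rewrite ltry|rewrite gt0_muley ?lte_fin].
pose g l := rearr f (pow2 (l%:~R * d%:R)).
have g0 l : 0 <= g l by rewrite (rearr_ge0 d0 f0 fM)// pow2_ge0.
pose c (l : int) := C^-1 * (pow2 (a * l%:~R) * (g l / 2) `^ (q - 1)).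
have c0 l : 0 <= c l.
  apply: mulr_ge0; first by rewrite invr_ge0 ltW.
  by apply: mulr_ge0; [exact: pow2_ge0|exact: powR_ge0].
exists (C * 2 `^ q * fine I).
  by rewrite mulr_ge0 ?fine_ge0// mulr_ge0 ?powR_ge0 ?(ltW C0).
move=> s us.
pose J l : set R := [set` `](g l / 2), (g l)[].
have mJ l : measurable (J l : set (measurableTypeR R)) by exact: measurable_itv.
have J0 l t : J l t -> 0 < t.
  by rewrite /J/= in_itv/= => /andP[+ _]; apply: le_lt_trans; rewrite divr_ge0.
have GF (t : R) : 0 < t -> ((\sum_(l <- s) c l * \1_(J l) t)%:E <= F t)%E.
  move=> t0.
  have tp0 : 0 < t `^ p by rewrite powR_gt0.
  have m0 : (0 <= distrib f t)%E by exact: lebesgue_outer_ge0.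
  rewrite /F; move Em : (distrib f t) m0 => m; case: m Em => // [r Em r0|Em _]; last first.
    rewrite gt0_mulye ?lte_fin// poweRyr ?gt0_mulye ?leey ?lte_fin ?invr_gt0//.
    by rewrite gt_eqF// divr_gt0.
  rewrite lee_fin in r0.
  rewrite -(EFinM r) poweR_EFin -EFinM lee_fin.
  rewrite powRM ?(ltW tp0)// -powRrM (_ : p * (q / p) = q); last by field; rewrite gt_eqF.
  rewrite -mulrA (_ : t `^ q * t^-1 = t `^ (q - 1)); last first.
    by rewrite -powR_inv1 ?(ltW t0)// -powRD// (gt_eqF t0) implybT.
  rewrite (bigID (fun l => t \in J l))/= [X in _ + X]big1 ?addr0; last first.
    by move=> l /negbTE tl; rewrite indicE tl mulr0.
  apply: (@le_trans _ _ (\sum_(l <- s | t \in J l) C^-1 * t `^ (q - 1) * pow2 (a * l%:~R))).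
    apply: ler_sum => l tl; rewrite indicE tl mulr1 /c.
    rewrite [leRHS](_ : _ = C^-1 * (pow2 (a * l%:~R) * t `^ (q - 1))); last by ring.
    rewrite ler_wpM2l ?invr_ge0 ?(ltW C0)// ler_wpM2l ?pow2_ge0//.
    move: tl; rewrite inE /J/= in_itv/= => /andP[tl _].
    by rewrite ge0_ler_powR ?nnegrE ?subr_ge0 ?divr_ge0 ?(ltW t0) ?(ltW tl).
  rewrite -mulr_sumr -big_filter mulrAC ler_wpM2r ?powR_ge0//.
  rewrite mulrC ler_pdivrMr// mulrC.
  apply: hC => //.
  - exact: filter_uniq.
  - move=> l; rewrite mem_filter => /andP[+ _].
    rewrite inE /J/= in_itv/= => /andP[_ tl].
    have := lt_rearr (pow2_ge0 _) (ltW t0) tl; rewrite Em lte_fin => lr.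
    rewrite (_ : a * l%:~R = l%:~R * d%:R * (q / p)); last by rewrite /a; ring.
    rewrite -pow2M ge0_ler_powR ?nnegrE ?pow2_ge0 ?(ltW lr)// ?(ltW r0)// ltW// divr_gt0//.
  - exact: powR_ge0.
have mD : measurable ([set t : R | 0 < t] : set (measurableTypeR R)).
  rewrite (_ : [set t : R | 0 < t] = [set` `]0, +oo[])//.
  by apply/seteqP; split => t /=; rewrite in_itv/= andbT.
have IG : (\int[@lebesgue_measure R]_(t in [set t : R | (0 < t)%R])
    (\sum_(l <- s) c l * \1_(J l) t)%:E = (\sum_(l <- s) c l * (g l / 2))%:E)%E.
  under eq_integral do rewrite -sumEFin.
  rewrite ge0_integral_sum//=; last 2 first.
  - by move=> l; apply/measurable_EFinP/measurable_funM.
  - by move=> l t _; rewrite lee_fin mulr_ge0// indicE; case: (_ \in _).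
  rewrite -sumEFin; apply: eq_bigr => l _.
  under eq_integral do rewrite EFinM.
  rewrite ge0_integralZl//; last 2 first.
  - by apply/measurable_EFinP; exact: (measurable_indic (mJ l)).
  - by rewrite lee_fin.
  rewrite (integral_indic _ _ (mJ l))// [RHS]EFinM; congr (_ * _)%E.
  rewrite setIidl; last by move=> t /J0.
  rewrite [LHS](lebesgue_measure_itv `](g l / 2), (g l)[)/= lte_fin.
  have := g0 l; rewrite le_eqVlt => /predU1P[<-|gl].
    by rewrite mul0r ltxx.
  rewrite ifT; last by rewrite ltr_pdivrMr//; lra.
  by rewrite -EFinB; congr EFin; lra.
have : ((\sum_(l <- s) c l * (g l / 2))%:E <= I)%E.
  rewrite -IG; apply: ge0_le_integral_nomeas => t /=; last exact: GF.
  move=> _; rewrite lee_fin sumr_ge0// => l _.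
  by rewrite mulr_ge0// indicE; case: (_ \in _).
rewrite -[I]fineK ?ge0_fin_numE// lee_fin => h.
apply: (@le_trans _ _ (C * 2 `^ q * \sum_(l <- s) c l * (g l / 2))); last first.
  by rewrite ler_wpM2l// mulr_ge0 ?powR_ge0 ?(ltW C0).
rewrite mulr_sumr; apply: ler_sum => l _.
rewrite /rearr_seq -/(g l) powRM ?pow2_ge0// pow2M.
rewrite (_ : l%:~R * d%:R / p * q = a * l%:~R); last by rewrite /a; ring.
rewrite [leRHS](_ : _ = (C / C) * (pow2 (a * l%:~R) *
   (2 `^ q * (g l / 2 * (g l / 2) `^ (q - 1))))); last by rewrite /c; ring.
rewrite mulfV ?gt_eqF// mul1r ler_wpM2l ?pow2_ge0//.
rewrite mulr_powRB1 ?divr_ge0// -powRM ?divr_ge0//.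
by rewrite mulrC divfK.
Qed.

End lorentz_sequence.

Lemma expr_small (R : realType) (t e : R) : 0 <= t < 1 -> 0 < e ->
  exists n : nat, t ^+ n <= e.
Proof.
move=> /andP[t0 t1] e0.
have /cvgrPdist_lt/(_ e e0)[n _ hn] : (t ^+ n @[n --> \oo] --> (0 : R)).
  by apply: cvg_expr; rewrite ger0_norm.
exists n; have := hn n (leqnn n); rewrite /= sub0r normrN ger0_norm ?exprn_ge0//.
exact: ltW.
Qed.

Lemma sum_sqr_le_sqr_sum (R : realType) (n : nat) (a : nat -> R) :
  (forall i, 0 <= a i) -> \sum_(i < n) a i ^+ 2 <= (\sum_(i < n) a i) ^+ 2.
Proof.
move=> a0; elim: n => [|n IH]; first by rewrite !big_ord0 expr0n.
rewrite !big_ord_recr/=.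
have : 0 <= \sum_(i < n) a i by exact: sumr_ge0.
have := a0 n; nra.
Qed.

(** * Decay of the energy across scales *)

Section energy_decay.
Context (R : realType) (d : nat) (p q : R).
Notation T := (d.-tuple R).
Hypotheses (d0 : (0 < d)%N) (p2 : 2 < p).
Variable Q : probability T R.
Variable D : R.
Hypothesis D0 : 0 < D.
Hypothesis Qbox : forall a b : T, (forall i, tnth a i <= tnth b i) ->
  (Q (box a b) <= (D * box_vol a b)%:E)%E.
Variables (f : T -> R) (M : R).
Hypotheses (mf : measurable_fun setT f) (f0 : forall x, 0 <= f x)
  (fM : forall x, f x <= M).

Definition scaled_energy (k : int) : R :=
  pow2 (k%:~R * d%:R / p) *
  Num.sqrt (Rintegral Q setT (fun z => f (dilate (pow2 k%:~R) z) ^+ 2)).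

(** The rearrangement is sampled at [2 ^ ((k - i) d)]; after the weight and the square root, layer
    [i] carries the factor [t ^ i] with [t = 2 ^ (d / p - d / 2)]. The error [e] absorbs the set
    above the last sample, so only [I] depends on [k] and [e]. *)
Lemma scaled_energy_decay : exists2 t : R, 0 <= t < 1 & exists2 C : R, 0 <= C &
  forall (k : int) (e : R), 0 < e -> exists I : nat,
    scaled_energy k <= C * \sum_(i < I) t ^+ i * rearr_seq p f (k - i%:Z) + e.
Proof.
have p0 : 0 < p by exact: lt_trans p2.
have dR : 0 < d%:R :> R by rewrite ltr0n.
pose y := d%:R / 2 - d%:R / p.
have y0 : 0 < y.
  by rewrite subr_gt0 ltr_pM2l// ltf_pV2 ?posrE.
pose t := pow2 (- y).
have t01 : 0 <= t < 1 by rewrite pow2_ge0 pow2_lt1 oppr_lt0.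
exists t => //.
have D2 : 0 < D * pow2 d%:R by rewrite mulr_gt0// pow2_gt0.
(* The value at sample [i + 1] is multiplied by the mass above sample [i], [D * 2 ^ (- i d)]; this
   shift costs the factor [2 ^ d]. The 1 serves the term [i = 0]. *)
exists (1 + D * pow2 d%:R); first by rewrite addr_ge0// ltW.
move=> k e e0.
have M0 : 0 <= M by exact: le_trans (f0 [tuple 0 | i < d]) (fM _).
pose w := pow2 (k%:~R * d%:R / p).
have w0 : 0 < w by exact: pow2_gt0.
pose g l := rearr f (pow2 (l * d%:R)).
pose x l := rearr_seq p f l.
have x0 l : 0 <= x l by exact: (rearr_seq_ge0 p d0 f0 fM).
have [I hI] : exists I : nat, w ^+ 2 * (M ^+ 2 * (D * pow2 (- d%:R) ^+ I)) <= e ^+ 2.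
  have c0 : 0 < w ^+ 2 * (M ^+ 2 + 1) * D.
    by rewrite !mulr_gt0 ?exprn_gt0// ltr_wpDl ?sqr_ge0.
  have [||n hn] := @expr_small R (pow2 (- d%:R)) (e ^+ 2 / (w ^+ 2 * (M ^+ 2 + 1) * D)).
  - by rewrite pow2_ge0 pow2_lt1 oppr_lt0.
  - by rewrite divr_gt0// exprn_gt0.
  exists n; rewrite ler_pdivlMr// in hn; apply: le_trans hn.
  rewrite [leRHS](_ : _ = w ^+ 2 * ((M ^+ 2 + 1) * (D * pow2 (- d%:R) ^+ n))); last by ring.
  rewrite ler_wpM2l ?sqr_ge0// ler_wpM2r ?mulr_ge0 ?exprn_ge0 ?pow2_ge0 ?(ltW D0)//.
  by rewrite lerDl.
exists I.+1; rewrite /scaled_energy.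
set E := Rintegral Q setT _.
have E0 : 0 <= E by apply: Rintegral_ge0 => z _; exact: sqr_ge0.
set S := \sum_(i < I.+1) _.
have S0 : 0 <= S by apply: sumr_ge0 => i _; rewrite mulr_ge0// exprn_ge0// pow2_ge0.
have rhs0 : 0 <= (1 + D * pow2 d%:R) * S + e.
  by rewrite addr_ge0 ?(ltW e0)// mulr_ge0// addr_ge0// ltW.
have lhs0 : 0 <= w * Num.sqrt E by rewrite mulr_ge0 ?sqrtr_ge0// ltW.
rewrite -/w -(ler_pXn2r (n := 2))// exprMn sqr_sqrtr//.
have EI := Rintegral_rearr D0 Qbox d0 mf f0 fM (l := fun i => pow2 ((k%:~R - i%:R) * d%:R)) I
  (pow2_gt0 k%:~R) (fun i => pow2_ge0 _).
rewrite -/E subr0 in EI.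
have De i : D / pow2 k%:~R ^+ d * pow2 ((k%:~R - i%:R) * d%:R) = D * pow2 (- d%:R) ^+ i.
  rewrite !pow2X -pow2N -mulrA -pow2D; congr (_ * pow2 _); ring.
have Ex (i : nat) : w * rearr f (pow2 ((k%:~R - i%:R) * d%:R)) =
    pow2 (i%:R * d%:R / p) * x (k - i%:Z).
  rewrite /x /rearr_seq intrB mulrA -pow2D; congr (pow2 _ * _); ring.
apply: (@le_trans _ _ ((1 + D * pow2 d%:R) ^+ 2 * \sum_(i < I.+1) (t ^+ i * x (k - i%:Z)) ^+ 2 + e ^+ 2)); last first.
  apply: (@le_trans _ _ ((1 + D * pow2 d%:R) ^+ 2 * S ^+ 2 + e ^+ 2)).
    rewrite lerD2r ler_wpM2l ?sqr_ge0//; apply: (@sum_sqr_le_sqr_sum R I.+1 (fun i => t ^+ i * x (k - i%:Z))) => i.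
    by rewrite mulr_ge0// exprn_ge0// pow2_ge0.
  rewrite -exprMn; have : 0 <= (1 + D * pow2 d%:R) * S by rewrite mulr_ge0// addr_ge0// ltW.
  by nra.
apply: (@le_trans _ _ (w ^+ 2 * (rearr f (pow2 (k%:~R * d%:R)) ^+ 2 +
   \sum_(i < I) rearr f (pow2 ((k%:~R - i.+1%:R) * d%:R)) ^+ 2 * (D * pow2 (- d%:R) ^+ i)
   + M ^+ 2 * (D * pow2 (- d%:R) ^+ I)))).
  rewrite ler_wpM2l ?sqr_ge0//; apply: (le_trans EI).
  by rewrite De; under eq_bigr do rewrite De.
rewrite mulrDr lerD// mulrDr -exprMn.
have := Ex 0%N; rewrite subr0 mul0r mul0r pow2_0 mul1r => ->.
rewrite big_ord_recl expr0 mul1r mulrDr lerD//.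
  rewrite ler_peMl ?sqr_ge0//.
  have : 0 <= D * pow2 d%:R by exact: ltW.
  by nra.
rewrite !mulr_sumr; apply: ler_sum => i _.
rewrite mulrA -exprMn Ex lift0; move: (x (k - i.+1%:Z)) => X.
rewrite (exprMn 2 _ X) (exprMn 2 (t ^+ _) X) [leLHS]mulrAC [leRHS]mulrA ler_wpM2r ?sqr_ge0//.
have -> : pow2 (i.+1%:R * d%:R / p) ^+ 2 * (D * pow2 (- d%:R) ^+ i) =
    D * pow2 d%:R * (t ^+ i.+1) ^+ 2.
  rewrite -exprM /t !pow2X mulrCA -!mulrA -!pow2D; congr (_ * pow2 _).
  rewrite /y natrM -natr1; field; rewrite gt_eqF//.
rewrite ler_wpM2r ?sqr_ge0//.
have : 0 <= D * pow2 d%:R by exact: ltW.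
by nra.
Qed.

End energy_decay.

(** * Discrete convolution and Young's inequality *)

Section summation.
Context (R : realType) (q t C B : R) (x X : int -> R).
Hypotheses (q1 : 1 <= q) (t01 : 0 <= t < 1) (C0 : 0 <= C) (B0 : 0 <= B).
Hypothesis x0 : forall l, 0 <= x l.
Hypothesis xB : forall s : seq int, uniq s -> \sum_(l <- s) x l `^ q <= B.
Hypothesis Xx : forall (k : int) (e : R), 0 < e -> exists I : nat,
  X k <= C * \sum_(i < I) t ^+ i * x (k - i%:Z) + e.

(** Some finite [s] nearly attains the supremum of all finite sums, and any indices beyond [s] can
    be appended to it. *)
Lemma tail_small (e : R) : 0 < e -> exists m : int, forall s : seq int, uniq s ->
  (forall l, l \in s -> m <= l) -> \sum_(l <- s) x l `^ q <= e.
Proof.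
move=> e0.
pose A := [set v | exists2 s : seq int, uniq s & v = \sum_(l <- s) x l `^ q].
have hA : has_sup A.
  split; first by exists 0, [::] => //; rewrite big_nil.
  by exists B => _ [s us ->]; exact: xB.
have [_ [s us ->] hs] := sup_adherent e0 hA.
have [m hm] : exists m : int, forall l, l \in s -> l < m.
  have [->|/seq_int_max[L _ hL]] := eqVneq s [::]; first by exists 0.
  by exists (L + 1) => l /hL; rewrite ltzD1.
exists m => s' us' ms'.
have : \sum_(l <- s ++ s') x l `^ q <= sup A.
  apply: ub_le_sup; first exact: hA.2.
  exists (s ++ s') => //; rewrite cat_uniq us us' andbT /=.
  apply/hasPn => l /ms' ml; apply/negP => /hm; rewrite ltNge ml//.
by rewrite big_cat/=; lra.
Qed.

(** The first [n] terms are small by assumption; the others are merely bounded but carry the factor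
    [t ^ n]. *)
Lemma geometric_tail (n I : nat) (a e : R) (y : nat -> R) :
  0 <= e -> 0 <= a -> (forall i, 0 <= y i) ->
  (forall i, y i <= a) -> (forall i, (i < n)%N -> y i <= e) ->
  \sum_(i < I) t ^+ i * y i <= (e + a * t ^+ n) / (1 - t).
Proof.
have [t0 t1] := andP t01.
move=> e0 a0 y0 ya ye.
have b i : t ^+ i * y i <= e * t ^+ i + a * ((n <= i)%N%:R * t ^+ i).
  have ti : 0 <= t ^+ i by exact: exprn_ge0.
  case: (leqP n i) => [ni|/ye yie]; last first.
    by rewrite mul0r mulr0 addr0 mulrC ler_wpM2r.
  by rewrite mul1r -mulrDl mulrC ler_wpM2r// (le_trans (ya i))// lerDr.
apply: (@le_trans _ _ (\sum_(i < I) (e * t ^+ i + a * ((n <= i)%N%:R * t ^+ i)))).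
  by apply: ler_sum => i _.
rewrite big_split/= -!mulr_sumr mulrDl lerD//.
  by rewrite ler_wpM2l// geometric_sum_le.
rewrite -mulrA ler_wpM2l//.
apply: (@le_trans _ _ (\sum_(0 <= i < n + I) (n <= i)%N%:R * t ^+ i)).
  rewrite -(big_mkord xpredT (fun i => (n <= i)%N%:R * t ^+ i)).
  rewrite [leRHS](big_cat_nat (n := I))//=; last exact: leq_addl.
  by rewrite lerDl sumr_ge0// => i _; rewrite mulr_ge0 ?exprn_ge0.
rewrite (big_cat_nat (n := n))//=; last exact: leq_addr.
rewrite [X in X + _]big1_seq ?add0r; last first.
  by move=> i /andP[_]; rewrite mem_index_iota => /andP[_ ni]; rewrite leqNgt ni mul0r.
rewrite -{1}(add0n n) big_addn addKn.
rewrite big_mkord (eq_bigr (fun i : 'I_I => t ^+ n * t ^+ i)); last first.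
  by move=> i _; rewrite leq_addl mul1r addnC exprD.
by rewrite -mulr_sumr ler_wpM2l ?exprn_ge0// geometric_sum_le.
Qed.

Lemma convolution_tail (e : R) : 0 < e -> exists k0 : int, forall (k1 : int) (K I : nat),
  k0 <= k1 -> \sum_(j < K) \sum_(i < I) t ^+ i * x (k1 + j%:Z - i%:Z) `^ q <= e.
Proof.
have [t0 t1] := andP t01.
have t1' : 0 < 1 - t by rewrite subr_gt0.
move=> e0.
have e1 : 0 < e * (1 - t) / 2 by rewrite divr_gt0// mulr_gt0.
have [m hm] := tail_small e1.
have [n hn] : exists n, t ^+ n <= e * (1 - t) / 2 / (B + 1).
  by apply: expr_small => //; rewrite divr_gt0// ltr_wpDl.
(* For [i < n] the index [k1 + j - i] then stays above [m], where the tail of [x] is small. *)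
exists (m + n%:Z) => k1 K I mk1.
rewrite exchange_big/=.
under eq_bigr do rewrite -mulr_sumr.
have us (i : nat) : uniq [seq k1 + j%:Z - i%:Z | j <- index_iota 0 K].
  by rewrite map_inj_uniq ?iota_uniq// => a b /addIr /addrI [].
have E (i : nat) : \sum_(j < K) x (k1 + j%:Z - i%:Z) `^ q =
    \sum_(l <- [seq k1 + j%:Z - i%:Z | j <- index_iota 0 K]) x l `^ q.
  by rewrite big_map big_mkord.
apply: (le_trans (geometric_tail (n := n) (a := B) (e := e * (1 - t) / 2) I
    (y := fun i => \sum_(j < K) x (k1 + j%:Z - i%:Z) `^ q) _ _ _ _ _)) => //.
- exact: ltW.
- by move=> i; apply: sumr_ge0 => j _; exact: powR_ge0.
- by move=> i; rewrite E; exact: xB.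
- move=> i ni; rewrite E; apply: hm => // l /mapP[j _ ->].
  by move: mk1 ni; lia.
rewrite ler_pdivrMr//.
have : B * t ^+ n <= e * (1 - t) / 2.
  rewrite ler_pdivlMr in hn; last by rewrite ltr_wpDl.
  apply: le_trans hn; rewrite mulrC ler_wpM2l ?exprn_ge0// lerDl//.
lra.
Qed.

(* [q / (q - 1)] is the dual exponent, read as infinity when [q = 1]. *)
Definition capacity_bound (c : R) (b : int -> R) : Prop :=
  (forall k, 0 <= b k) /\
  if q == 1 then forall k, b k <= c
  else forall s : seq int, uniq s -> \sum_(k <- s) b k `^ (q / (q - 1)) <= c.

(* Young's inequality, in a form that covers the endpoint [q = 1]. *)
Lemma capacity_Young (c h : R) : 0 <= c -> 0 < h -> exists2 A : R, 0 <= A &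
  forall b, capacity_bound c b -> exists2 u : int -> R, (forall k, 0 <= u k) &
  (forall s : seq int, uniq s -> \sum_(k <- s) u k <= c) /\
  forall k (v : R), 0 <= v -> b k * v <= h * u k + A * v `^ q.
Proof.
move=> c0 h0.
have q0 : 0 < q by exact: lt_le_trans q1.
have [q1e|q1n] := eqVneq q 1.
  exists c => // b [b0]; rewrite q1e eqxx => bc.
  exists (fun=> 0) => //; split; first by move=> s _; rewrite big1.
  by move=> k v v0; rewrite mulr0 add0r powRr1// ler_wpM2r.
have qp : 0 < q - 1 by rewrite subr_gt0 lt_def q1n.
pose q' := q / (q - 1).
have q'0 : 0 < q' by rewrite divr_gt0.
have conj : q'^-1 + q^-1 = 1.
  by rewrite /q'; field; rewrite !gt_eqF.
(* Young's inequality is applied to [l * b k] and [v / l]; this [l] makes the coefficient of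
   [b k ^ q'] equal to [h]. *)
pose l := (h * q') `^ (q'^-1).
have l0 : 0 < l by rewrite powR_gt0// mulr_gt0.
exists ((l^-1) `^ q / q); first by rewrite divr_ge0 ?powR_ge0// ltW.
move=> b [b0]; rewrite (negbTE q1n) => bc.
exists (fun k => b k `^ q'); first by move=> k; exact: powR_ge0.
split => // k v v0.
have li0 : 0 <= l^-1 by rewrite invr_ge0 ltW.
have := @conjugate_powR R (l * b k) (l^-1 * v) q' q
  (mulr_ge0 (ltW l0) (b0 k)) (mulr_ge0 li0 v0) q'0 q0 conj.
rewrite mulrACA mulfV ?gt_eqF// mul1r => /le_trans; apply.
rewrite !powRM ?(ltW l0)//.
rewrite {1}/l -powRrM mulVf ?gt_eqF// powRr1 ?mulr_ge0 ?(ltW h0) ?(ltW q'0)//.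
- by rewrite le_eqVlt; apply/orP; left; apply/eqP; field; rewrite !gt_eqF.
- exact: ltW.
- by rewrite invr_ge0 ltW.
Qed.

(** [k0] may not depend on [b], which comes from a cover chosen only after its mesh. So [h] is fixed
    first and makes the [u] part at most [e / 3] for every admissible [b]; this determines [A], and
    [k0] is taken so far out that the convolution tail times [C * A] is at most [e / 3]. The last
    third pays for the truncation errors. *)
Lemma small_sum (c e : R) : 0 <= c -> 0 < e -> exists k0 : int,
  forall (k1 : int) (b : int -> R) (K : nat), k0 <= k1 -> capacity_bound c b ->
  \sum_(j < K) b (k1 + j%:Z) * X (k1 + j%:Z) <= e.
Proof.
have [t0 t1] := andP t01.
have t1' : 0 < 1 - t by rewrite subr_gt0.
move=> c0 e0.
have Z0 : 0 <= C * c / (1 - t) by rewrite divr_ge0 ?(ltW t1')// mulr_ge0.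
have [h h0 hE] : exists2 h, 0 < h & h * (C * c / (1 - t) + 1) = e / 3.
  exists (e / 3 / (C * c / (1 - t) + 1)); first by rewrite !divr_gt0// ltr_wpDl.
  by rewrite divfK// gt_eqF// ltr_wpDl.
have [A A0 hA] := capacity_Young c0 h0.
have e2 : 0 < e / 3 / (C * A + 1) by rewrite !divr_gt0// ltr_wpDl// mulr_ge0.
have [k0 hk0] := convolution_tail e2.
exists k0 => k1 b K k01 bc.
have [u u0 [uc bu]] := hA b bc.
have b0 := bc.1.
(* Error allowed at level [j], scaled so that even after multiplication by [b] the [K] errors add up
   to at most [e / 3]. *)
pose ek (j : nat) := e / 3 / (K.+1%:R * (b (k1 + j%:Z) + 1)).
have ek0 j : 0 < ek j.
  by rewrite !divr_gt0// mulr_gt0// ltr_wpDl.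
have bek j : b (k1 + j%:Z) * ek j <= e / 3 / K.+1%:R.
  rewrite /ek invfM; have := b0 (k1 + j%:Z); move: (b _) => y y0.
  have y1 : 0 < y + 1 by rewrite ltr_wpDl.
  rewrite (_ : y * _ = (y / (y + 1)) * (e / 3 / K.+1%:R)); last first.
    by field; rewrite !gt_eqF//= addrC natr1.
  rewrite ler_piMl ?divr_ge0 ?(ltW e0)// ler_pdivrMr// mul1r lerDl//.
(* A common [I] exists because the partial sums increase with [I]. *)
have [I hI] : exists I : nat, forall j : nat, (j < K)%N ->
    X (k1 + j%:Z) <= C * \sum_(i < I) t ^+ i * x (k1 + j%:Z - i%:Z) + ek j.
  have mono (j I I' : nat) : (I <= I')%N ->
      \sum_(i < I) t ^+ i * x (k1 + j%:Z - i%:Z) <= \sum_(i < I') t ^+ i * x (k1 + j%:Z - i%:Z).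
    move=> II'.
    rewrite -!(big_mkord xpredT (fun i => t ^+ i * x (k1 + j%:Z - i%:Z))).
    rewrite [leRHS](big_cat_nat (n := I))//= lerDl sumr_ge0// => i _.
    by rewrite mulr_ge0 ?exprn_ge0.
  elim: K {bek} ek ek0 => [|K IH] ek ek0; first by exists 0%N.
  have [I hI] := IH ek ek0; have [I' hI'] := Xx (k1 + K%:Z) (ek0 K).
  exists (maxn I I') => j; rewrite ltnS leq_eqVlt => /predU1P[->|/hI h'].
    by apply: (le_trans hI'); rewrite lerD2r ler_wpM2l// mono// leq_maxr.
  by apply: (le_trans h'); rewrite lerD2r ler_wpM2l// mono// leq_maxl.
have step (j : nat) : (j < K)%N -> b (k1 + j%:Z) * X (k1 + j%:Z) <=
    C * (h / (1 - t)) * u (k1 + j%:Z) + C * A * \sum_(i < I) t ^+ i * x (k1 + j%:Z - i%:Z) `^ q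
    + e / 3 / K.+1%:R.
  move=> jK; apply: (le_trans (ler_wpM2l (b0 _) (hI j jK))).
  rewrite mulrDr lerD//.
  rewrite mulrCA -!mulrA -mulrDr ler_wpM2l// mulr_sumr.
  apply: (@le_trans _ _ (\sum_(i < I) (t ^+ i * (h * u (k1 + j%:Z)) +
     A * (t ^+ i * x (k1 + j%:Z - i%:Z) `^ q)))).
    apply: ler_sum => i _; rewrite [leLHS]mulrCA.
    rewrite [leRHS](_ : _ = t ^+ i * (h * u (k1 + j%:Z) + A * x (k1 + j%:Z - i%:Z) `^ q)); last by ring.
    by rewrite ler_wpM2l ?exprn_ge0// bu.
  rewrite big_split/= -mulr_sumr lerD2r -mulr_suml.
  rewrite [leRHS](_ : _ = (1 - t)^-1 * (h * u (k1 + j%:Z))); last by ring.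
  by rewrite ler_wpM2r ?mulr_ge0 ?(ltW h0)// geometric_sum_le.
apply: (@le_trans _ _ (\sum_(j < K) (C * (h / (1 - t)) * u (k1 + j%:Z) +
    C * A * \sum_(i < I) t ^+ i * x (k1 + j%:Z - i%:Z) `^ q + e / 3 / K.+1%:R))).
  by apply: ler_sum => j _; exact: step.
rewrite !big_split/= -!mulr_sumr sumr_const card_ord.
have S1 : \sum_(j < K) u (k1 + j%:Z) <= c.
  have := uc [seq k1 + j%:Z | j <- index_iota 0 K].
  rewrite big_map big_mkord; apply.
  by rewrite map_inj_uniq ?iota_uniq// => a a' /addrI [].
have S2 := hk0 k1 K I k01.
have T1 : C * (h / (1 - t)) * \sum_(j < K) u (k1 + j%:Z) <= e / 3.
  apply: (@le_trans _ _ (h * (C * c / (1 - t) + 1))); last first.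
    by rewrite hE.
  apply: (@le_trans _ _ (C * (h / (1 - t)) * c)).
    by rewrite ler_wpM2l// mulr_ge0// divr_ge0 ?(ltW h0) ?(ltW t1').
  rewrite mulrDr mulr1 (_ : C * (h / (1 - t)) * c = h * (C * c / (1 - t))); last by ring.
  by rewrite lerDl ltW.
have T2 : C * A * \sum_(j < K) \sum_(i < I) t ^+ i * x (k1 + j%:Z - i%:Z) `^ q <= e / 3.
  have CA : 0 <= C * A by rewrite mulr_ge0.
  apply: (le_trans (ler_wpM2l CA S2)).
  rewrite mulrA ler_pdivrMr ?ltr_wpDl// mulrC ler_wpM2l ?divr_ge0 ?(ltW e0)// lerDl//.
have T3 : e / 3 / K.+1%:R *+ K <= e / 3.
  rewrite -mulr_natr -mulrA ler_piMr ?divr_ge0 ?(ltW e0)//.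
  by rewrite mulrC ler_pdivrMr// mul1r ler_nat.
rewrite -mulrnAr in T3.
by apply: (le_trans (lerD (lerD T1 T2) T3)); rewrite le_eqVlt; apply/orP; left; apply/eqP; field.
Qed.

End summation.

(** * Hierarchical splines *)

Section tent_refinement.
Context (R : realType).
Implicit Type y : R.

(** The two-scale relation with weights 1/2, 1, 1/2 at the shifts -1, 0, 1; the index [e] encodes
    the shift [e - 1]. *)
Lemma tent_refine y :
  tent y = \sum_(e < 3) (if e == 1 :> nat then 1 else 2^-1) * tent (2 * y - (e%:Z - 1)%:~R).
Proof.
rewrite !big_ord_recl big_ord0 /= !tentE.
rewrite !rmorphB/= /bump/=.
have E (a b : R) : a = 2 * b -> `|a| = 2 * `|b|.
  by move=> ->; rewrite normrM ger0_norm.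
rewrite (E (2 * y - _ + 1) (y + 1)); last by ring.
rewrite (E (2 * y - (2%:~R - 1) - 1) (y - 1)); last by ring.
rewrite (E (2 * y - (1%:~R - 1)) y); last by ring.
rewrite (E (2 * y - (0%:~R - 1) - 1) y); last by ring.
rewrite (E (2 * y - (2%:~R - 1) + 1) y); last by ring.
rewrite (_ : 2 * y - (0%:~R - 1) = 2 * y + 1); last by ring.
rewrite (_ : 2 * y - (1%:~R - 1) + 1 = 2 * y + 1); last by ring.
rewrite (_ : 2 * y - (1%:~R - 1) - 1 = 2 * y - 1); last by ring.
rewrite (_ : 2 * y - (2%:~R - 1) = 2 * y - 1); last by ring.
by field.
Qed.

(** The second differences telescope, leaving one increment of the absolute value at each end of the
    grid. *)
Lemma sum_tent (M : nat) y :
  \sum_(m < M.+1) tent (y - m%:R) =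
  (`|y + 1| - `|y| + (`|y - M.+1%:R| - `|y - M%:R|)) / 2.
Proof.
elim: M => [|M IH].
  by rewrite big_ord1 tentE subr0; field.
rewrite big_ord_recr IH/= tentE.
rewrite (_ : y - M.+1%:R + 1 = y - M%:R); last by rewrite -natr1; ring.
rewrite (_ : y - M.+1%:R - 1 = y - M.+2%:R); last by rewrite -[in RHS]natr1; ring.
by field.
Qed.

Lemma sum_tent_le1 (M : nat) y : \sum_(m < M.+1) tent (y - m%:R) <= 1.
Proof.
rewrite sum_tent ler_pdivrMr// mul1r.
have := ler_normD y 1; rewrite normr1.
have := ler_normD (y - M%:R) (-1); rewrite normrN1.
rewrite (_ : y - M%:R + -1 = y - M.+1%:R); last by rewrite -natr1; ring.
lra.
Qed.

Lemma sum_tent_eq1 (M : nat) y : 0 <= y <= M%:R -> \sum_(m < M.+1) tent (y - m%:R) = 1.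
Proof.
move=> /andP[y0 yM]; rewrite sum_tent (ger0_norm y0) ger0_norm ?addr_ge0//.
rewrite (ler0_norm (x := y - M%:R)) ?subr_le0// ler0_norm ?subr_le0.
  by rewrite -natr1; field.
by rewrite -natr1 ler_wpDr.
Qed.

Lemma tent_gt0 y : (0 < tent y) = (`|y| < 1).
Proof. by rewrite /tent lt_max ltxx/= subr_gt0. Qed.

End tent_refinement.

Section splines.
Context (R : realType) (d : nat).
Notation T := (d.-tuple R).
Notation idx := (d.-tuple int).
Implicit Type s : R.

Definition node (s : R) (n : idx) : T := [tuple (tnth n i)%:~R / s | i < d].

Lemma hat_node s n m : s != 0 -> hat s n (node s m) = (n == m)%:R.
Proof.
move=> s0; rewrite /hat.
under eq_bigr do rewrite tnth_mktuple mulrC divfK// -intrB tent_int subr_eq0.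
have [->|nm] := eqVneq n m; first by rewrite big1// => i _; rewrite eqxx.
have [i ni] : exists i, tnth m i != tnth n i.
  apply/existsP; apply: contraNT nm; rewrite negb_exists => /forallP h.
  by apply/eqP/eq_from_tnth => i; have := h i; rewrite negbK => /eqP.
by rewrite (bigD1 i)//= (negbTE ni) mul0r.
Qed.

(* The coefficients of a combination of the hats are its values at the nodes. *)
Definition is_spline (s : R) (g : T -> R) := exists S : seq idx, uniq S /\
  forall x, g x = \sum_(n <- S) g (node s n) * hat s n x.

Lemma spline_sumP s g (S : seq idx) (c : idx -> R) : s != 0 -> uniq S ->
  (forall x, g x = \sum_(n <- S) c n * hat s n x) ->
  forall m, g (node s m) = (m \in S)%:R * c m.
Proof.
move=> s0 uS gE m; rewrite gE; have [mS|mS] := boolP (m \in S).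
  rewrite mul1r (bigD1_seq m)//= hat_node// eqxx mulr1 big1 ?addr0// => n /negbTE nm.
  by rewrite hat_node// nm mulr0.
rewrite mul0r big1_seq// => n /andP[_ nS]; rewrite hat_node//.
by case: eqVneq nS mS => [->->|]//; rewrite mulr0.
Qed.

Lemma is_splineI s g (S : seq idx) (c : idx -> R) : s != 0 -> uniq S ->
  (forall x, g x = \sum_(n <- S) c n * hat s n x) -> is_spline s g.
Proof.
move=> s0 uS gE; exists S; split => // x; rewrite {1}gE big_seq [RHS]big_seq.
by apply: eq_bigr => n nS; rewrite (spline_sumP s0 uS gE) nS mul1r.
Qed.

Lemma is_spline_widen s g (S S' : seq idx) : s != 0 -> uniq S -> uniq S' ->
  {subset S <= S'} -> (forall x, g x = \sum_(n <- S) g (node s n) * hat s n x) ->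
  forall x, g x = \sum_(n <- S') g (node s n) * hat s n x.
Proof.
move=> s0 uS uS' SS' gE x; rewrite gE.
rewrite (perm_big [seq i <- S' | i \in S])/=; last first.
  apply: uniq_perm => //; first exact: filter_uniq.
  by move=> i; rewrite mem_filter; case: (boolP (i \in S)) => //= /SS' ->.
rewrite big_filter big_mkcond/=; apply: eq_bigr => n _.
case: ifPn => // nS; rewrite (spline_sumP s0 uS gE) (negbTE nS) !mul0r//.
Qed.

Lemma splineZ s a g : s != 0 -> is_spline s g -> is_spline s (fun x => a * g x).
Proof.
move=> s0 [S [uS gE]]; apply: (is_splineI (c := fun n => a * g (node s n)) s0 uS) => x.
by rewrite gE mulr_sumr; apply: eq_bigr => n _; rewrite mulrA.
Qed.

Lemma splineD s g h : s != 0 -> is_spline s g -> is_spline s h ->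
  is_spline s (fun x => g x + h x).
Proof.
move=> s0 [S [uS gE]] [S' [uS' hE]].
exists (undup (S ++ S')); split; first exact: undup_uniq.
have uu := undup_uniq (S ++ S').
move=> x; rewrite (is_spline_widen s0 uS uu _ gE); last first.
  by move=> i iS; rewrite mem_undup mem_cat iS.
rewrite (is_spline_widen s0 uS' uu _ hE); last first.
  by move=> i iS; rewrite mem_undup mem_cat iS orbT.
by rewrite -big_split/=; apply: eq_bigr => n _; rewrite mulrDl.
Qed.

Lemma spline_sum s (I : Type) (r : seq I) (g : I -> T -> R) : s != 0 ->
  (forall i, is_spline s (g i)) -> is_spline s (fun x => \sum_(i <- r) g i x).
Proof.
move=> s0 gs; elim: r => [|i r IH].
  by apply: (is_splineI (S := [::]) (c := fun=> 0) s0) => // x; rewrite !big_nil.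
under eq_fun do rewrite big_cons.
exact: splineD.
Qed.

Lemma spline_hat s n : s != 0 -> is_spline s (hat s n).
Proof.
by move=> s0; apply: (is_splineI (S := [:: n]) (c := fun=> 1) s0) => // x;
  rewrite big_seq1 mul1r.
Qed.

Lemma hat_refine s n x : hat s n x = \sum_(f : {ffun 'I_d -> 'I_3})
  (\prod_(i < d) (if f i == 1 :> nat then 1 else 2^-1 : R)) *
  hat (2 * s) [tuple 2 * tnth n i + ((f i)%:Z - 1) | i < d] x.
Proof.
rewrite /hat; under eq_bigr do rewrite tent_refine.
rewrite bigA_distr_bigA/=; apply: eq_bigr => f _; rewrite -big_split/=.
apply: eq_bigr => i _; rewrite tnth_mktuple [in RHS]intrD [in RHS]intrM; congr (_ * tent _).
by rewrite mulrBr mulrA opprD addrA.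
Qed.

Lemma spline_refine (s : R) g : s != 0 -> is_spline s g -> is_spline (2 * s) g.
Proof.
move=> s0 [S [uS gE]]; have s20 : 2 * s != 0 by rewrite mulf_neq0.
rewrite (funext gE); apply: spline_sum => // n; apply: splineZ => //.
rewrite (funext (hat_refine s n)).
by apply: spline_sum => // f; apply: splineZ => //; exact: spline_hat.
Qed.

(* [psi] is carried by the cells of the lattice that meet [G]. *)
Definition active_part s (G : set T) (psi : T -> R) := exists (S : seq idx) (c : idx -> R),
  [/\ uniq S, forall n, n \in S -> exists2 x, G x & 0 < hat s n x,
      forall n, n \in S -> 0 <= c n <= 1 &
      forall x, psi x = \sum_(n <- S) c n * hat s n x].

(** A hat that does not meet [G] vanishes on [G], hence so does the rest [r]. The coefficients are
    values of [g], so they lie in [0, 1] and both parts are nonnegative. *)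
Lemma active_split s (G : set T) g : s != 0 -> is_spline s g ->
  (forall x, 0 <= g x <= 1) -> exists psi r : T -> R,
  [/\ active_part s G psi, is_spline s r, forall x, g x = psi x + r x,
      forall x, 0 <= r x <= g x & forall x, G x -> r x = 0].
Proof.
move=> s0 [S [uS gE]] g01.
pose act n := `[< exists2 x, G x & 0 < hat s n x >].
pose psi x := \sum_(n <- [seq n <- S | act n]) g (node s n) * hat s n x.
pose r x := \sum_(n <- [seq n <- S | ~~ act n]) g (node s n) * hat s n x.
have gpr x : g x = psi x + r x by rewrite gE (bigID act)/= /psi /r !big_filter.
have term n x : 0 <= g (node s n) * hat s n x.
  by rewrite mulr_ge0 ?hat_ge0//; have /andP[] := g01 (node s n).
exists psi, r; split => //.
- exists [seq n <- S | act n], (g \o node s); split => //.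
  + exact: filter_uniq.
  + by move=> n; rewrite mem_filter => /andP[/asboolP].
  + by move=> n _; exact: g01.
- by apply: (is_splineI (S := [seq n <- S | ~~ act n]) (c := g \o node s) s0) => //; exact: filter_uniq.
- by move=> x; rewrite sumr_ge0//= gpr lerDr sumr_ge0.
- move=> x Gx; rewrite /r big1_seq// => n /andP[_]; rewrite mem_filter => /andP[nn _].
  apply/eqP; rewrite mulf_eq0; apply/orP; right; rewrite eq_le hat_ge0 andbT leNgt.
  by apply: contra nn => h; apply/asboolP; exists x.
Qed.

(** The remainders decrease, so what vanishes on an earlier [G j] keeps vanishing there, and the
    bounds 0 and 1 needed for the next splitting persist under refinement. *)
Lemma spline_telescope (k0 : int) (G : nat -> set T) g (K : nat) :
  is_spline (pow2 k0%:~R) g -> (forall x, 0 <= g x <= 1) ->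
  exists (psi : nat -> T -> R) (r : T -> R),
  [/\ forall j, (j < K)%N -> active_part (pow2 (k0 + j%:Z)%:~R) (G j) (psi j),
      is_spline (pow2 (k0 + K%:Z)%:~R) r,
      forall x, g x = \sum_(j < K) psi j x + r x,
      forall x, 0 <= r x <= g x &
      forall j x, (j < K)%N -> G j x -> r x = 0].
Proof.
move=> gs g01; elim: K => [|K [psi [r [psiP rs gE r0 rG]]]].
  exists (fun _ _ => 0), g; split => // [|x|x].
  - by rewrite addr0.
  - by rewrite big_ord0 add0r.
  - by have /andP[-> _] := g01 x; rewrite lexx.
have r01 x : 0 <= r x <= 1.
  by have /andP[-> /le_trans->] := r0 x; last by have /andP[] := g01 x.
have [psi' [r' [psi'P r's rE r'0 r'G]]] := active_split (G K) (pow2_neq0 _ ) rs r01.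
exists (fun j => if j == K then psi' else psi j), r'; split.
- by move=> j; rewrite ltnS leq_eqVlt; case: eqVneq => [->//|_ /= jK]; exact: psiP.
- have -> : pow2 (k0 + K.+1%:Z)%:~R = 2 * pow2 (k0 + K%:Z)%:~R :> R.
    have -> : (k0 + K.+1%:Z)%:~R = 1 + (k0 + K%:Z)%:~R :> R.
      by rewrite intS addrCA [LHS]intrD.
    by rewrite pow2D {1}/pow2 powRr1.
  exact: spline_refine (pow2_neq0 _) r's.
- move=> x; rewrite big_ord_recr/= eqxx gE rE addrA; congr (_ + _ + _).
  by apply: eq_bigr => i _; rewrite ltn_eqF.
- by move=> x; have /andP[-> /le_trans->] := r'0 x; last by have /andP[] := r0 x.
- move=> j x; rewrite ltnS leq_eqVlt => /predU1P[->|jK Gx]; first exact: r'G.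
  have := rG _ _ jK Gx; have := r'0 x; move=> h e; move: h; rewrite e => h.
  by apply/eqP; rewrite eq_le andbC.
Qed.

Lemma hat_gt0 s (n : idx) (x : T) : 0 < hat s n x -> forall i, `|s * tnth x i - (tnth n i)%:~R| < 1.
Proof.
move=> h i; rewrite -tent_gt0 lt_def tent_ge0 andbT.
by apply: contraTN h => /eqP e; rewrite /hat (bigD1 i)//= e mul0r ltxx.
Qed.

(** The hats of a large grid form a partition of unity on [F]. Those meeting [F] already sum to 1
    there, and each has support of width [2 / s] in every coordinate. *)
Lemma spline_cutoff s (F : set T) (N : R) : 0 < s ->
  (forall x, F x -> forall i, `|tnth x i| <= N) -> exists chi : T -> R,
  [/\ is_spline s chi, forall x, 0 <= chi x <= 1, forall x, F x -> chi x = 1 &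
      forall x, chi x != 0 -> exists2 y, F y & forall i, `|tnth x i - tnth y i| <= 2 / s].
Proof.
move=> s0 FN; have sn0 : s != 0 by rewrite gt_eqF.
(* The grid indices run from [- L] to [L] in each coordinate, which covers [F] after scaling by
   [s]. *)
pose L := (Num.truncn (s * N)).+1.
have NL x : F x -> forall i, `|s * tnth x i| <= L%:R.
  move=> Fx i; rewrite normrM gtr0_norm//.
  apply: le_trans (_ : s * N <= _); first by rewrite ler_pM2l// FN.
  exact/ltW/truncnS_gt.
pose g x := \sum_(f : {ffun 'I_d -> 'I_(L + L).+1}) hat s [tuple (f i)%:Z - L%:Z | i < d] x.
have gE x : g x = \prod_(i < d) \sum_(m < (L + L).+1) tent ((s * tnth x i + L%:R) - m%:R).
  rewrite bigA_distr_bigA; apply: eq_bigr => f _; apply: eq_bigr => i _.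
  by rewrite tnth_mktuple intrB opprB addrA.
have gs : is_spline s g by apply: spline_sum => // f; exact: spline_hat.
have g01 x : 0 <= g x <= 1.
  rewrite gE prodr_ge0/= => [|i _]; last by apply: sumr_ge0 => m _; exact: tent_ge0.
  apply: prodr_ile1 => i _; rewrite sum_tent_le1 andbT.
  by apply: sumr_ge0 => m _; exact: tent_ge0.
have g1 x : F x -> g x = 1.
  move=> Fx; rewrite gE big1// => i _; apply: sum_tent_eq1.
  by have := NL _ Fx i; rewrite ler_norml natrD => /andP[]; lra.
have [psi [r [[S [c [uS Sact c01 psiE]]] rs gpr r0 rF]]] := active_split F sn0 gs g01.
have psi0 x : 0 <= psi x.
  rewrite psiE big_seq sumr_ge0// => n nS; rewrite mulr_ge0 ?hat_ge0//.
  by have /andP[] := c01 _ nS.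
exists psi; split.
- exact: is_splineI sn0 uS psiE.
- move=> x; rewrite psi0/=.
  have := gpr x; have /andP[] := r0 x; have /andP[] := g01 x; lra.
- by move=> x Fx; have := gpr x; rewrite (rF _ Fx) addr0 g1.
- move=> x; rewrite psiE => /eqP h.
  have [n nS hn] : exists2 n, n \in S & 0 < hat s n x.
    apply: contrapT => hh; apply: h; rewrite big1_seq// => n /andP[_ nS].
    apply/eqP; rewrite mulf_eq0; apply/orP; right; rewrite eq_le hat_ge0 andbT leNgt.
    by apply/negP => ?; apply: hh; exists n.
  have [y Fy hy] := Sact _ nS; exists y => // i.
  rewrite ler_pdivlMr// mulrC -[X in X * _](gtr0_norm s0) -normrM.
  have := hat_gt0 hn i; have := hat_gt0 hy i.
  rewrite !ltr_norml mulrBr ler_norml => /andP[? ?] /andP[? ?]; apply/andP; split; lra.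
Qed.

End splines.

(** Continuity from above along the decreasing sets [U] minus the first [K] of the [E n], available
    as [nu] is finite. It turns countable unions into finite ones, both for regularity and for the
    levels of a cover. *)
Lemma finite_remainder d (T : measurableType d) (R : realType)
    (nu : {measure set T -> \bar R}) (U : set T) (E : nat -> set T) (e e' : R) :
  (nu setT < +oo)%E -> measurable U -> (forall n, measurable (E n)) ->
  (nu (U `\` \bigcup_n E n) <= e%:E)%E -> 0 < e' ->
  exists K : nat, (nu (U `\` \bigcup_(n < K) E n) <= (e + e')%:E)%E.
Proof.
move=> nuT mU mE nue e0.
pose D K := U `\` \bigcup_(n < K) E n.
have mD K : measurable (D K).
  by apply: measurableD => //; apply: bigcup_measurable => n _.
have DE : \bigcap_K D K = U `\` \bigcup_n E n.
  apply/seteqP; split=> [x h|x [Ux nE] K _].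
    split; first by have [] := h 0%N I.
    by move=> [n _ Enx]; have [_] := h n.+1 I; apply; exists n => //=.
  by split => // -[n _ Enx]; apply: nE; exists n.
have mI : measurable (\bigcap_K D K).
  by rewrite DE; apply: measurableD => //; exact: bigcup_measurable.
have cv : nu \o D @ \oo --> nu (\bigcap_K D K).
  apply: nonincreasing_cvg_mu => //.
    apply: le_lt_trans nuT; apply: le_measure; rewrite ?inE//.
  move=> m n mn; apply/subsetPset => x [Ux nE]; split => // -[k /= km Ek].
  by apply: nE; exists k => //=; exact: leq_trans km mn.
apply: contrapT => h.
have : (((e + e')%:E <= lim (nu \o D @ \oo))%E).
  apply: lime_ge; first by apply/cvg_ex; eexists; exact: cv.
  by apply: nearW => K; rewrite leNgt; apply/negP => hK; apply: h; exists K; exact: ltW.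
rewrite (cvg_lim _ cv)// DE => /le_trans/(_ nue).
by rewrite lee_fin leNgt ltrDl e0.
Qed.

(** * Regularity of finite measures *)

Section regularity.
Context (R : realType) (d : nat).
Notation T := (d.-tuple R).
Variable nu : {measure set T -> \bar R}.
Hypothesis nuT : (nu setT < +oo)%E.

(** Regularity by a positive distance between [F] and the complement of [U] instead of by closed and
    open sets: this form passes to complements at once, and a cutoff spline of fine mesh fits into
    the gap. *)
Definition sandwiched (A : set T) := forall e : R, 0 < e -> exists (F U : set T) (rho : R),
  [/\ measurable F /\ measurable U, F `<=` A /\ A `<=` U, 0 < rho,
      forall x y, F y -> (forall i, `|tnth x i - tnth y i| <= rho) -> U x &
      (nu (U `\` F) <= e%:E)%E].

Lemma sandwichedC A : sandwiched A -> sandwiched (~` A).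
Proof.
move=> hA e e0; have [F [U [rho [[mF mU] [FA AU] r0 FU nue]]]] := hA e e0.
exists (~` U), (~` F), rho; split => //.
- by split; exact: measurableC.
- by split; exact: subsetC.
- move=> x y nUy xy Fx; apply: nUy; apply: FU Fx _ => i.
  by rewrite distrC.
- by rewrite setDE setCK setIC -setDE.
Qed.

(** All the [U n] are kept but only finitely many [F n], so that the least of finitely many [rho n]
    serves; [finite_remainder] bounds the mass given up. *)
Lemma sandwiched_bigcup (A : nat -> set T) : (forall n, sandwiched (A n)) ->
  sandwiched (\bigcup_n A n).
Proof.
move=> hA e e0.
have e2 : 0 < e / 2 by rewrite divr_gt0.
have en n : 0 < e / 2 / (2 ^ n.+1)%:R by rewrite divr_gt0// ltr0n expn_gt0.
have /choice[F /choice[U /choice[rho hF]]] n := hA n _ (en n).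
have mF n : measurable (F n) by have [[]] := hF n.
have mU n : measurable (U n) by have [[]] := hF n.
have FA n : F n `<=` A n by have [_ []] := hF n.
have AU n : A n `<=` U n by have [_ []] := hF n.
have rho0 n : 0 < rho n by have [] := hF n.
have mUF n : measurable (U n `\` F n) by exact: measurableD.
have mbU : measurable (\bigcup_n U n) by exact: bigcup_measurable.
have mbF : measurable (\bigcup_n F n) by exact: bigcup_measurable.
have nuD : (nu (\bigcup_n U n `\` \bigcup_n F n) <= (e / 2)%:E)%E.
  apply: le_trans (_ : \sum_(0 <= n <oo) nu (U n `\` F n) <= _)%E.
    apply: measure_sigma_subadditive => //; first exact: measurableD.
    by move=> x [[n _ Unx] nF]; exists n => //; split => // Fnx; apply: nF; exists n.
  apply: le_trans (epsilon_trick0 xpredT (ltW e2)).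
  apply: lee_nneseries => // n _.
  by have [_ _ _ _] := hF n.
have [K hK] := finite_remainder nuT mbU mF nuD e2.
have [r r0 rK] : exists2 r : R, 0 < r & forall n, (n < K)%N -> r <= rho n.
  elim: K {hK} => [|K [r r0 IH]]; first by exists 1.
  exists (Num.min r (rho K)); first by rewrite lt_min r0 rho0.
  move=> n; rewrite ltnS leq_eqVlt ge_min => /predU1P[->|/IH->//].
  by rewrite lexx orbT.
exists (\bigcup_(n < K) F n), (\bigcup_n U n), r; split => //.
- by split => //; apply: bigcup_measurable.
- split; last by move=> x [n _ /AU Ux]; exists n.
  by move=> x [n _ /FA Ax]; exists n.
- move=> x y [n /= nK Fny] xy; exists n => //; have [_ _ _ + _] := hF n.
  by apply; first exact: Fny; move=> i; exact: le_trans (xy i) (rK n nK).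
- by move: hK; rewrite -splitr.
Qed.

Lemma sandwiched_halfspace (i : 'I_d) (a : R) : sandwiched [set x | a < tnth x i].
Proof.
move=> e e0.
pose F n := [set x : T | a + n.+1%:R^-1 < tnth x i].
have mH b : measurable [set x : T | b < tnth x i].
  rewrite (_ : [set x | _] = (@tnth d R ^~ i) @^-1` `]b, +oo[).
    by rewrite -[X in measurable X]setTI; apply: measurable_tnth.
  by apply/seteqP; split => x /=; rewrite in_itv/= andbT.
have [|K] := @finite_remainder _ _ _ nu _ F 0 e nuT (mH a) (fun n => mH _) _ e0.
  rewrite (_ : _ `\` _ = set0) ?measure0// -subset0 => x [/= ax]; apply.
  have [n hn] := @ltr_add_invr _ _ _ ax.
  by exists n.
rewrite add0r => hK.
exists (\bigcup_(n < K) F n), [set x | a < tnth x i], (K.+1%:R^-1); split => //.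
- by split => //; apply: bigcup_measurable => n _; exact: mH.
- by split => // x [n _]; apply: lt_trans; rewrite ltrDl.
- move=> x y [n /= nK Fy] /(_ i).
  have : K.+1%:R^-1 <= n.+1%:R^-1 :> R by rewrite lef_pV2 ?posrE// ler_nat ltnW.
  have {}Fy : a + n.+1%:R^-1 < tnth y i by exact: Fy.
  rewrite ler_norml /=; move: (K.+1%:R^-1) (n.+1%:R^-1) Fy => u v ? ? /andP[? _]; lra.
Qed.

(** The sandwiched sets form a sigma-algebra, and it contains the open half-spaces, which generate
    the measurable structure coordinate by coordinate. *)
Lemma measurable_sandwiched (A : set T) : measurable A -> sandwiched A.
Proof.
have s0 : sandwiched set0.
  move=> e e0; exists set0, set0, 1; split => //; first by split.
  by rewrite setD0 measure0 lee_fin ltW.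
apply: smallest_sub A; first split => //.
- by move=> A sA; rewrite setTD; exact: sandwichedC.
- exact: sandwiched_bigcup.
apply: (big_ind (fun S => S `<=` sandwiched)) => //; first by move=> A B hA hB C [/hA|/hB].
move=> i _ _ [B mB <-]; rewrite setTI.
have {mB} : <<s @RGenOInfty.G R >> B.
  by rewrite -[X in X B](RGenOInfty.measurableE R).
move: B; apply: smallest_sub => /=; first split.
- by rewrite preimage_set0.
- by move=> B hB; rewrite setTD preimage_setC; exact: sandwichedC.
- by move=> B hB; rewrite preimage_bigcup; exact: sandwiched_bigcup.
move=> _ [a ->]; rewrite (_ : _ @^-1` _ = [set x | a < tnth x i]).
  exact: sandwiched_halfspace.
by apply/seteqP; split => x /=; rewrite in_itv/= andbT.
Qed.

(** Cutting [F] by a large box costs little mass and lets finitely many hats cover it. *)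
Lemma bounded_sandwich (A : set T) (e : R) : measurable A -> 0 < e ->
  exists (F U : set T) (rho N : R),
  [/\ measurable F /\ measurable U, F `<=` A /\ A `<=` U,
      forall x, F x -> forall i, `|tnth x i| <= N,
      0 < rho /\ forall x y, F y -> (forall i, `|tnth x i - tnth y i| <= rho) -> U x &
      (nu (U `\` F) <= e%:E)%E].
Proof.
move=> mA e0; have e2 : 0 < e / 2 by rewrite divr_gt0.
have [F [U [rho [[mF mU] [FA AU] r0 FU nue]]]] := measurable_sandwiched mA e2.
pose B (n : nat) : set T := box [tuple - n%:R | i < d] [tuple n%:R | i < d].
have mFB n : measurable (F `&` B n) by apply: measurableI => //; exact: measurable_box.
have [|K hK] := @finite_remainder _ _ _ nu U (fun n => F `&` B n) (e / 2) (e / 2)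
    nuT mU mFB _ e2.
  apply: le_trans nue; apply: le_measure; rewrite ?inE//.
  - by apply: measurableD => //; apply: bigcup_measurable => n _.
  - exact: measurableD.
  move=> x [Ux nF]; split => // Fx; apply: nF.
  pose n := (Num.truncn (\sum_(i < d) `|tnth x i|)).+1.
  exists n => //; split => // i; rewrite !tnth_mktuple -ler_norml.
  apply: le_trans (ltW (truncnS_gt _)); rewrite (bigD1 i)//= lerDl.
  exact: sumr_ge0.
exists (\bigcup_(n < K) (F `&` B n)), U, rho, K%:R; split => //.
- by split => //; apply: bigcup_measurable.
- by split => // x [n _ [/FA]].
- move=> x [n /= nK [_ /= Bx]] i; have := Bx i; rewrite !tnth_mktuple -ler_norml.
  by move=> /le_trans; apply; rewrite ler_nat ltnW.
- by split => // x y [n _ [Fy _]]; exact: FU.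
- by move: hK; rewrite -splitr.
Qed.

End regularity.

(** * Covers and capacity *)

Section covers.
Context (R : realType) (d : nat).
Notation T := (d.-tuple R).
Notation idx := (d.-tuple int).

Lemma le_edist (x y : T) (i : 'I_d) : `|tnth x i - tnth y i| <= Defs.edist x y.
Proof.
rewrite -sqrtr_sqr ler_wsqrtr// (bigD1 i)//= lerDl.
by apply: sumr_ge0 => j _; exact: sqr_ge0.
Qed.

Lemma measurable_eball (c : T) (r : R) : measurable (eball c r).
Proof.
have m : measurable_fun setT (fun x : T => Defs.edist x c).
  apply: (measurableT_comp (f := @Num.sqrt R)).
    by apply: continuous_measurable_fun; exact: sqrt_continuous.
  apply: measurable_sum => i; apply: measurable_funX.
  by apply: measurable_funB => //; exact: measurable_tnth.
rewrite (_ : eball c r = (fun x : T => Defs.edist x c) @^-1` `]-oo, r[).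
  by rewrite -[X in measurable X]setTI; apply: m.
by apply/seteqP; split => x /=; rewrite in_itv.
Qed.

Lemma dyadic_levelP (k : int) (u : R) :
  dyadic_level k u <-> pow2 (- k%:~R - 1) <= u /\ u < pow2 (- k%:~R).
Proof.
rewrite /dyadic_level -!(pow2_int R).
by rewrite intrB intrN.
Qed.

Lemma dyadic_level_exists (u : R) : 0 < u -> exists k, dyadic_level k u.
Proof.
move=> u0.
have l2 : 0 < ln 2 :> R by rewrite ln_gt0// ltr1n.
have uE : u = pow2 (ln u / ln 2).
  rewrite /pow2 /powR pnatr_eq0/= divfK ?gt_eqF// lnK//.
pose m := Num.floor (ln u / ln 2).
(* Here [2 ^ m <= u < 2 ^ (m + 1)], to be read as [2 ^ (- k - 1) <= u < 2 ^ (- k)]. *)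
exists (- m - 1); apply/dyadic_levelP; rewrite {1}uE {2}uE ler_pow2 ltr_pow2.
have := ge_floor (ln u / ln 2); have := floorD1_gt (ln u / ln 2).
rewrite -/m intrD intrB intrN; lra.
Qed.

Section cover.
Variables (c : nat -> T) (r : nat -> R).

Definition level_balls (k : int) : set T :=
  \bigcup_(j in [set j | dyadic_level k (2 * r j)]) eball (c j) (r j).

Lemma measurable_level_balls k : measurable (level_balls k).
Proof. by apply: bigcup_measurable => j _; exact: measurable_eball. Qed.

Lemma cover_level_balls (k0 : int) (A : set T) :
  (forall j, 2 * r j < pow2 (- k0%:~R)) -> A `<=` \bigcup_j eball (c j) (r j) ->
  A `<=` \bigcup_(j : nat) level_balls (k0 + j%:Z).
Proof.
move=> rk0 cov x /cov[j _ xj].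
have r0 : 0 < 2 * r j.
  by rewrite mulr_gt0//; apply: le_lt_trans xj; exact: sqrtr_ge0.
have [k kj] := dyadic_level_exists r0.
have k0k : k0 <= k.
  have /dyadic_levelP[kr _] := kj; have := le_lt_trans kr (rk0 j).
  by rewrite ltr_pow2 ltrBlDr ltrNl opprD opprK ltrBlDr -intrD1 ltr_int ltzD1.
exists `|k - k0|%N => //; exists j => //=.
by rewrite gez0_abs ?subr_ge0// addrCA subrr addr0.
Qed.

Lemma level_sum_ge (alpha : R) k (J : seq nat) : 0 < alpha -> uniq J ->
  (forall j, j \in J -> dyadic_level k (2 * r j)) ->
  (((size J)%:R * pow2 ((- k%:~R - 1) * alpha))%:E <= level_sum alpha r k)%E.
Proof.
move=> a0 uJ Jk; rewrite /level_sum.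
pose N := (\sum_(j <- J) j).+1%N.
apply: le_trans (nneseries_lim_ge N _); last by move=> n _ _; rewrite lee_fin powR_ge0.
rewrite sumEFin lee_fin big_mkcond/=.
apply: (@le_trans _ _ (\sum_(j <- J) if `[< dyadic_level k (2 * r j) >] then
    (2 * r j) `^ alpha else 0)).
  rewrite mulr_natl -iter_addr_0 -(count_predT J) -big_const_seq.
  rewrite big_seq [leRHS]big_seq; apply: ler_sum => j jJ.
  have kj := Jk _ jJ; rewrite (asboolT kj) -pow2M ge0_ler_powR ?nnegrE ?pow2_ge0//.
  - exact: ltW.
  - by have /dyadic_levelP[h _] := kj; apply: le_trans h; exact: pow2_ge0.
  - by have /dyadic_levelP[] := kj.
apply: ler_sum_uniq_sub => //.
- exact: iota_uniq.
- by move=> j jJ; rewrite mem_index_iota ltnS /N (big_rem j)//= leq_addr.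
- by move=> j; case: ifP => // _; exact: powR_ge0.
Qed.

(* A ball of diameter less than [2 ^ - k] meets the supports of at most [4 ^ d]
   hats of scale [2 ^ k]. *)
Lemma size_active_le (alpha : R) k (S : seq idx) : 0 < alpha -> uniq S ->
  (forall n, n \in S -> exists2 x, level_balls k x & 0 < hat (pow2 k%:~R) n x) ->
  (((size S)%:R * pow2 ((- k%:~R - 1) * alpha))%:E <= (4 ^ d)%:R%:E * level_sum alpha r k)%E.
Proof.
move=> a0 uS Sact.
have /choice[j jP] (n : idx) : exists j : nat, n \in S ->
    dyadic_level k (2 * r j) /\ exists2 x, eball (c j) (r j) x & 0 < hat (pow2 k%:~R) n x.
  have [nS|nS] := boolP (n \in S); last by exists 0%N.
  by have [x [j kj xj] nx] := Sact _ nS; exists j => _; split => //; exists x.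
pose m n i := Num.floor (pow2 k%:~R * tnth (c (j n)) i).
(* The index is within 1 of the scaled point and the point within 1/2 of the scaled centre, whose
   integer part is [m n i]; this leaves four integers per coordinate. *)
have mP n i : n \in S -> (m n i - 1 <= tnth n i < m n i + 3).
  move=> /jP[/dyadic_levelP[_ rk] [x xj nx]].
  have hx := hat_gt0 nx i.
  have xc : `|pow2 k%:~R * tnth x i - pow2 k%:~R * tnth (c (j n)) i| < 1 / 2.
    rewrite -mulrBr normrM gtr0_norm ?pow2_gt0//.
    apply: le_lt_trans (_ : pow2 k%:~R * r (j n) < _).
      by rewrite ler_pM2l ?pow2_gt0// (le_trans (le_edist _ _ _))// ltW.
    rewrite ltr_pdivlMr// -mulrA mulrC -ltr_pdivlMr ?pow2_gt0// mul1r -pow2N.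
    by rewrite mulrC.
  have fl := ge_floor (pow2 k%:~R * tnth (c (j n)) i).
  have fu := floorD1_gt (pow2 k%:~R * tnth (c (j n)) i).
  rewrite -/(m n i) intrD in fl fu; move: hx xc fl fu.
  rewrite !ltr_norml => /andP[? ?] /andP[? ?] ? ?; apply/andP; split.
    rewrite -ltzD1 -(ltr_int R) !intrD intrN; lra.
  rewrite -(ltr_int R) intrD; lra.
pose code n : {ffun 'I_d -> 'I_4} := [ffun i => inord `|(tnth n i - (m n i - 1))%R|%N].
have code_inj n n' : n \in S -> n' \in S -> j n = j n' -> code n = code n' -> n = n'.
  move=> nS n'S jj cc; apply/eq_from_tnth => i.
  have /ffunP/(_ i) := cc; rewrite !ffunE => /(congr1 (@nat_of_ord _)) e.
  have mm : m n i = m n' i by rewrite /m jj.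
  have /andP[] := mP _ i nS; have /andP[] := mP _ i n'S; move: e; rewrite mm.
  move: (tnth n i) (tnth n' i) (m n' i) => u v w e *; move: e.
  by rewrite !inordK; lia.
pose J := undup [seq j n | n <- S].
have JS : (size S <= size J * 4 ^ d)%N.
  pose L := [seq (a, f) | a <- J, f <- enum {: {ffun 'I_d -> 'I_4}}].
  have -> : (size J * 4 ^ d = size L)%N.
    by rewrite size_allpairs -cardE card_ffun !card_ord.
  rewrite -(size_map (fun n => (j n, code n))); apply: uniq_leq_size.
    by rewrite map_inj_in_uniq// => n n' nS n'S [jj cc]; exact: code_inj.
  move=> _ /mapP[n nS ->]; apply/allpairsP; exists (j n, code n); split => //=.
    by rewrite mem_undup map_f.
  by rewrite mem_enum.
have Jk a : a \in J -> dyadic_level k (2 * r a).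
  by rewrite mem_undup => /mapP[n /jP[h _] ->].
have := level_sum_ge a0 (undup_uniq _) Jk.
rewrite -/J => h; apply: (@le_trans _ _ ((4 ^ d)%:R%:E * ((size J)%:R * pow2 ((- k%:~R - 1) * alpha))%:E)%E).
  by rewrite -EFinM lee_fin mulrA ler_wpM2r ?pow2_ge0// -natrM ler_nat mulnC.
by rewrite lee_wpmul2l// lee_fin.
Qed.

Lemma level_sum_ge0 (alpha : R) k : (0 <= level_sum alpha r k)%E.
Proof. by apply: nneseries_ge0 => j _ _; rewrite lee_fin powR_ge0. Qed.

Definition level_mass (alpha : R) (k : int) : R := Num.sqrt (fine (level_sum alpha r k)).

(** [B + 1] serves both cases: for [q = 1] it bounds the square root of a number at most [B], and
    otherwise [level_mass ^ q'] is the level sum to the power [q' / 2]. *)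
Lemma cover_capacity_bound (alpha q B : R) : 1 <= q -> 0 <= B ->
  (cover_cost alpha (dual_exp q * (2^-1)%:E)%E r <= B%:E)%E ->
  (forall k, (level_sum alpha r k < +oo)%E) /\ capacity_bound q (B + 1) (level_mass alpha).
Proof.
move=> q1 B0; rewrite /dual_exp /capacity_bound.
have [q1e|q1n] := eqVneq q 1.
  rewrite gt0_mulye ?lte_fin//= => h.
  have hB k : (level_sum alpha r k <= B%:E)%E.
    by apply: le_trans h; apply: ereal_sup_ubound; exists k.
  have fin k : (level_sum alpha r k < +oo)%E by apply: le_lt_trans (hB k) (ltry _).
  split=> //; split => k; first exact: sqrtr_ge0.
  have f0 : 0 <= fine (level_sum alpha r k) by rewrite fine_ge0// level_sum_ge0.
  have : fine (level_sum alpha r k) <= B.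
    by rewrite -lee_fin fineK// ge0_fin_numE ?level_sum_ge0.
  rewrite /level_mass; move: (fine _) f0 => a a0 aB.
  have := sqr_sqrtr a0; have := sqrtr_ge0 a; nra.
rewrite -EFinM /=; set b := _ / 2 => h.
have qp : 0 < q - 1 by rewrite subr_gt0 lt_def q1n.
have b0 : 0 < b by rewrite /b !divr_gt0// (lt_le_trans _ q1).
have sB (s : seq int) : uniq s ->
    (\sum_(k <- s) poweR (level_sum alpha r k) b <= B%:E)%E.
  move=> us; apply: le_trans h; apply: esum_ge.
  exists [set` s]; first by split => //; exact: finite_seq.
  by rewrite fsbig_seq.
have fin k : (level_sum alpha r k < +oo)%E.
  apply: (@lty_poweRy _ _ b); first by rewrite gt_eqF.
  have := sB [:: k]; rewrite big_seq1 => /(_ isT) /le_lt_trans; apply.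
  exact: ltry.
split=> //; split=> [k|s us]; first exact: sqrtr_ge0.
have := sB s us.
rewrite (eq_bigr (fun k => (level_mass alpha k `^ (q / (q - 1)))%:E)) => [|k _].
  by rewrite sumEFin lee_fin => /le_trans; apply; rewrite lerDl.
have fk : level_sum alpha r k \is a fin_num by rewrite ge0_fin_numE ?level_sum_ge0.
rewrite -[in LHS](fineK fk) poweR_EFin /level_mass -powR12_sqrt ?fine_ge0 ?level_sum_ge0//.
by rewrite -powRrM /b mulrC.
Qed.

End cover.

(** The capacity is a supremum over the mesh, so one [B] strictly above it bounds the cost of some
    cover at every mesh. *)
Lemma NH_cover (alpha : R) (beta : \bar R) (A : set T) : (NH alpha beta A < +oo)%E ->
  exists2 B : R, 0 <= B & forall delta, 0 < delta -> exists (c : nat -> T) (r : nat -> R),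
    [/\ forall j, 2 * r j < delta, A `<=` \bigcup_j eball (c j) (r j) &
        (cover_cost alpha beta r <= B%:E)%E].
Proof.
move=> hA.
have [B B0 hB] : exists2 B : R, 0 <= B & (NH alpha beta A < B%:E)%E.
  move: hA; case: (NH alpha beta A) => [a _|//|_]; last first.
    by exists 0 => //; exact: ltNyr.
  exists (`|a| + 1); first by rewrite addr_ge0.
  by rewrite lte_fin (le_lt_trans (ler_norm a))// ltrDl.
exists B => // delta delta0.
have : (NH_delta alpha beta A delta < B%:E)%E.
  by apply: le_lt_trans hB; apply: ereal_sup_ubound; exists delta.
move=> /ereal_inf_lt[_ [c [r [_ [rd [cov ->]]]]] /ltW h].
by exists c, r.
Qed.

End covers.

(** * Vanishing of the measure on sets of finite capacity *)

Section main.
Context (R : realType) (d : nat).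
Notation T := (d.-tuple R).

(** The squares of the coefficients sum to at most the number of hats. As [alpha = 2 d / p], the
    factor [2 ^ (k alpha)] in that count is the square of the weight in [scaled_energy]; [2 ^ alpha]
    is the loss from diameters as small as [2 ^ (- k - 1)]. *)
Lemma active_part_bound (Q : probability T R) (p : R) (mu1 mu2 mu3 mu4 : {finite_measure set T -> \bar R})
  (c : nat -> T) (r : nat -> R) (k : int) (psi : T -> R) :
  (forall u : T,
    Rintegral Q setT (fun z => cos (2 * pi * dotp u z)) = \prod_(i < d) tent (tnth u i) /\
    Rintegral Q setT (fun z => sin (2 * pi * dotp u z)) = 0) ->
  (0 < d)%N -> 0 < p -> (level_sum (2 * d%:R / p) r k < +oo)%E ->
  active_part (pow2 k%:~R) (level_balls c r k) psi ->
  `|Rintegral mu1 setT psi - Rintegral mu2 setT psi| <=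
  Num.sqrt ((4 ^ d)%:R * pow2 (2 * d%:R / p)) * (level_mass r (2 * d%:R / p) k *
    scaled_energy p Q (fourier_abs mu1 mu2 mu3 mu4) k).
Proof.
move=> Qchar d0 p0 fin [S [a [uS Sact a01 psiE]]].
set alpha := 2 * d%:R / p.
have alpha0 : 0 < alpha by rewrite divr_gt0// mulr_gt0// ltr0n.
rewrite (funext psiE).
have := energy_bound Qchar (pow2 k%:~R) a mu1 mu2 mu3 mu4 uS.
set D := _ - _; set E := energy _ _ _ _ _ _ => hD.
have E0 : 0 <= E by apply: Rintegral_ge0 => z _; exact: sqr_ge0.
have Ssum : \sum_(n <- S) a n ^+ 2 <= (size S)%:R.
  rewrite -sum1_size natr_sum big_seq [leRHS]big_seq; apply: ler_sum => n nS.
  by have /andP[? ?] := a01 _ nS; rewrite expr_le1.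
have f0 : 0 <= fine (level_sum alpha r k) by rewrite fine_ge0// level_sum_ge0.
have hS : (size S)%:R <= (4 ^ d)%:R * pow2 alpha * fine (level_sum alpha r k) * pow2 (k%:~R * d%:R / p) ^+ 2.
  have := size_active_le alpha0 uS Sact.
  rewrite -[level_sum _ _ _]fineK ?ge0_fin_numE ?level_sum_ge0// -EFinM lee_fin.
  rewrite -ler_pdivlMr ?pow2_gt0// -pow2N => /le_trans; apply.
  rewrite pow2X (_ : - ((- k%:~R - 1) * alpha) = alpha + k%:~R * d%:R / p * 2%:R); last first.
    by rewrite /alpha; ring.
  by rewrite pow2D le_eqVlt; apply/orP; left; apply/eqP; ring.
have w0 : 0 <= (4 ^ d)%:R * pow2 alpha :> R by rewrite mulr_ge0// pow2_ge0.
rewrite -(ler_pXn2r (n := 2))// ?nnegrE//; last first.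
  by rewrite mulr_ge0 ?sqrtr_ge0// mulr_ge0 ?sqrtr_ge0// mulr_ge0 ?sqrtr_ge0 ?pow2_ge0.
rewrite real_normK ?num_real//; apply: (le_trans hD).
apply: (le_trans (ler_wpM2r E0 (le_trans Ssum hS))).
rewrite /scaled_energy !exprMn !sqr_sqrtr// -[Rintegral _ _ _]/E.
by rewrite le_eqVlt; apply/orP; left; apply/eqP; ring.
Qed.

Lemma bm_indic (A : set T) : measurable A -> bounded_measurable (\1_A : T -> R).
Proof.
move=> mA; split; first exact: measurable_indic.
by exists 1 => x; rewrite indicE; case: (x \in A); rewrite ?normr1 ?normr0.
Qed.

Lemma Rintegral_indicT (m : {finite_measure set T -> \bar R}) (A : set T) : measurable A ->
  Rintegral m setT (\1_A : T -> R) = fine (m A).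
Proof. by move=> mA; rewrite /Rintegral integral_indic// setIT. Qed.

Lemma fine_measure_approx (m : {finite_measure set T -> \bar R}) (A U F V : set T) (g : T -> R) :
  measurable A -> measurable U -> measurable F -> measurable V -> bounded_measurable g ->
  (forall x, `|\1_A x - g x| <= \1_(U `\` F) x + \1_(U `\` V) x) ->
  `|fine (m A) - Rintegral m setT g| <= fine (m (U `\` F)) + fine (m (U `\` V)).
Proof.
move=> mA mU mF mV bg h.
have mUF : measurable (U `\` F) by exact: measurableD.
have mUV : measurable (U `\` V) by exact: measurableD.
rewrite -!Rintegral_indicT// -bm_RintegralD; [|exact: bm_indic..].
rewrite -bm_RintegralB//; last exact: bm_indic.
rewrite ler_norml; apply/andP; split.
  rewrite -mulN1r -bm_RintegralZ; last by apply: bmD; exact: bm_indic.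
  apply: bm_le_Rintegral.
  - by apply: bmZ; apply: bmD; exact: bm_indic.
  - by apply: bmB => //; exact: bm_indic.
  - by move=> x; have := h x; rewrite ler_norml mulN1r => /andP[].
apply: bm_le_Rintegral.
- by apply: bmB => //; exact: bm_indic.
- by apply: bmD; exact: bm_indic.
- by move=> x; have := h x; rewrite ler_norml => /andP[].
Qed.

Lemma dist_approx (a b u v e : R) :
  `|a - u| <= 3 * e -> `|b - v| <= 3 * e -> `|u - v| <= e -> `|a - b| <= 7 * e.
Proof.
rewrite !ler_norml => /andP[? ?] /andP[? ?] /andP[? ?].
by apply/andP; split; lra.
Qed.

(** The order of choices matters. The sandwich and the bound [B], valid at every mesh, fix the
    starting level [k1]; only then is a cover of mesh [2 ^ - k1] taken, and the number [K] of levels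
    comes last. This is possible because [small] is uniform in the cover and in [K]. *)
Lemma real_part_vanishes (p q : R) (mu1 mu2 mu3 mu4 : {finite_measure set T -> \bar R})
  (A : set T) : (0 < d)%N -> 2 < p -> 1 <= q ->
  in_lorentz (fourier_abs mu1 mu2 mu3 mu4) p q -> measurable A ->
  (NH (2 * d%:R / p) (dual_exp q * (2^-1)%:E)%E A < +oo)%E -> mu1 A = mu2 A.
Proof.
move=> d0 p2 q1 Lf mA hA.
set f := fourier_abs mu1 mu2 mu3 mu4.
have p0 : 0 < p by exact: lt_trans p2.
have [P [C0 PC0] Ptent] := tent_char R.
have [C Cp PC] : exists2 C : R, 0 < C & forall a b : R, a <= b ->
    (P [set` `[a, b]] <= (C * (b - a))%:E)%E.
  (* The maximum with 1 makes the constant positive, as the estimates with [C ^ d] require. *)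
  exists (Num.max C0 1) => [|a b ab]; first by rewrite lt_max ltr01 orbT.
  apply: (le_trans (PC0 a b ab)).
  by rewrite lee_fin ler_wpM2r ?subr_ge0// le_max lexx.
have [Q Qbox Qchar] := tent_prod_char PC Ptent d.
have [mf [M fM']] := bm_fourier_abs Q mu1 mu2 mu3 mu4.
have f0 x : 0 <= f x by exact: sqrtr_ge0.
have fM x : f x <= M by apply: le_trans (fM' x); exact: ler_norm.
have [t t01 [C1 C10 decay]] := scaled_energy_decay d0 p2 (exprn_gt0 d Cp) Qbox mf f0 fM.
have [B1 B10 summ] := rearr_seq_summable d0 p2 q1 f0 fM Lf.
have x0 := rearr_seq_ge0 p d0 f0 fM.
have small := small_sum q1 t01 C10 B10 x0 summ decay.
have [B B0 covers] := NH_cover hA.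
set alpha := 2 * d%:R / p in hA covers.
have [W W0 WE] : exists2 W, 0 < W & W = Num.sqrt ((4 ^ d)%:R * pow2 alpha) :> R.
  exists (Num.sqrt ((4 ^ d)%:R * pow2 alpha)) => //.
  by rewrite sqrtr_gt0 mulr_gt0 ?pow2_gt0// ltr0n expn_gt0.
have fin1 : mu1 A \is a fin_num by exact: fin_num_measure.
have fin2 : mu2 A \is a fin_num by exact: fin_num_measure.
suff : forall e : R, 0 < e -> `|fine (mu1 A) - fine (mu2 A)| <= 7 * e.
  move=> h; rewrite -(fineK fin1) -(fineK fin2); congr (_%:E).
  apply/eqP; rewrite -subr_eq0 -normr_eq0 eq_le normr_ge0 andbT.
  apply/ler_addgt0Pr => e e0; rewrite add0r.
  have := h (e / 7); rewrite divr_gt0// mulrC divfK//; exact.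
move=> e e0.
(* One measure dominating both [mu1] and [mu2], so that a single sandwich controls both errors. *)
pose nu : {measure set T -> \bar R} := measure_add mu1 mu2.
have nuE X : nu X = (mu1 X + mu2 X)%E by exact: measure_addE.
have nuT : (nu setT < +oo)%E by rewrite nuE lte_add_pinfty// fin_num_fun_lty.
have [F [U [rho [N [[mF mU] [FA AU] FN [rho0 FU] nuUF]]]]] := bounded_sandwich nuT mA e0.
have eW : 0 < e / W by rewrite divr_gt0.
have B10' : 0 <= B + 1 by rewrite addr_ge0.
have [k0 hk0] := small _ _ B10' eW.
(* [2 / pow2 k1] is how far the cutoff reaches beyond [F]; it must not exceed [rho] for the support
   to stay in [U]. *)
have [k1 k01 k1rho] : exists2 k1 : int, k0 <= k1 & 2 / pow2 k1%:~R <= rho.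
  exists (Num.max k0 (Num.ceil (ln (2 / rho) / ln 2))); first by rewrite le_max lexx.
  have r2 : 0 < 2 / rho by rewrite divr_gt0.
  have l2 : 0 < ln 2 :> R by rewrite ln_gt0// ltr1n.
  rewrite ler_pdivrMr ?pow2_gt0// -ler_pdivrMl// mulrC.
  apply: (@le_trans _ _ (pow2 (ln (2 / rho) / ln 2))).
    by rewrite /pow2 /powR pnatr_eq0/= divfK ?gt_eqF// lnK.
  rewrite ler_pow2; apply: le_trans (ceil_ge _) _.
  by rewrite ler_int le_max lexx orbT.
have [c [r [rk cov cost]]] := covers _ (pow2_gt0 (- k1%:~R)).
have [lfin cap] := cover_capacity_bound q1 B0 cost.
pose E (j : nat) := level_balls c r (k1 + j%:Z).
have mE j : measurable (E j) by exact: measurable_level_balls.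
have covE : A `<=` \bigcup_j E j by exact: cover_level_balls.
have [K hK] : exists K : nat, (nu (U `\` \bigcup_(n < K) E n) <= (e + e)%:E)%E.
  apply: finite_remainder => //; apply: le_trans nuUF.
  apply: le_measure; rewrite ?inE.
  - by apply: measurableD => //; exact: bigcup_measurable.
  - exact: measurableD.
  - by move=> x [Ux nE]; split => // /FA /covE.
set V := \bigcup_(n < K) E n in hK.
have mV : measurable V by exact: bigcup_measurable.
have [chi [chis chi01 chiF chiU]] := spline_cutoff (pow2_gt0 k1%:~R) FN.
have [psi [rm [psiP _ chiE rm0 rmE]]] := spline_telescope E K chis chi01.
have bpsi (j : 'I_K) : bounded_measurable (psi j).
  have [S [a [_ _ _ psiE]]] := psiP _ (ltn_ord j).
  by rewrite (funext psiE); apply: bm_sum => n; apply: bmZ; exact: bm_hat.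
(* Outside [U] both functions vanish, and on [F] within [V] both equal 1, as the remainder is 0
   there. On [F] outside [V] the remainder is at most 1, and on the rest of [U] the two functions
   lie in [0, 1]. *)
have bound x : `|\1_A x - \sum_(j < K) psi j x| <= \1_(U `\` F) x + \1_(U `\` V) x.
  have -> : \sum_(j < K) psi j x = chi x - rm x by rewrite chiE addrK.
  rewrite !indicE.
  have /andP[chi0 chi1] := chi01 x; have /andP[rx0 rxc] := rm0 x.
  have [Ux|nUx] := pselect (U x); last first.
    have nA : ~ A x by move=> /AU.
    have chix : chi x = 0.
      apply: contrapT => /eqP /chiU[y Fy xy]; apply: nUx; apply: FU Fy _ => i.
      exact: le_trans (xy i) k1rho.
    rewrite !memNset//; try by case.
    have -> : rm x = 0 by apply/eqP; rewrite eq_le rx0 andbT -chix.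
    by rewrite chix !subr0 normr0 addr0.
  have [Fx|nFx] := pselect (F x).
    rewrite (mem_set (FA _ Fx)) chiF// memNset; last by case.
    rewrite opprB addrC subrK add0r ger0_norm//.
    have [Vx|nVx] := pselect (V x).
      by have [j jK Ex] := Vx; rewrite (rmE j)// memNset => [|[]].
    by rewrite mem_set// (le_trans rxc).
  rewrite [x \in U `\` F]mem_set//.
  apply: (@le_trans _ _ 1); last by rewrite lerDl.
  move: (chi x) (rm x) chi0 chi1 rx0 rxc; clear => u v *.
  by case: (x \in A); rewrite ler_norml; apply/andP; split => /=; lra.
have approx (m : {finite_measure set T -> \bar R}) : (forall X, measurable X -> m X <= nu X)%E ->
    `|fine (m A) - \sum_(j < K) Rintegral m setT (psi j)| <= 3 * e.
  move=> mnu; rewrite -bm_Rintegral_sum//.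
  apply: (le_trans (fine_measure_approx m mA mU mF mV _ bound)); first exact: bm_sum.
  have mUF : measurable (U `\` F) by exact: measurableD.
  have mUV : measurable (U `\` V) by exact: measurableD.
  have h1 : fine (m (U `\` F)) <= e.
    by rewrite -lee_fin fineK ?fin_num_measure//; apply: le_trans nuUF; exact: mnu.
  have h2 : fine (m (U `\` V)) <= e + e.
    by rewrite -lee_fin fineK ?fin_num_measure//; apply: le_trans hK; exact: mnu.
  by move: h1 h2; clear; lra.
have a1 : `|fine (mu1 A) - \sum_(j < K) Rintegral mu1 setT (psi j)| <= 3 * e.
  by apply: approx => X mX; rewrite nuE leeDl.
have a2 : `|fine (mu2 A) - \sum_(j < K) Rintegral mu2 setT (psi j)| <= 3 * e.
  by apply: approx => X mX; rewrite nuE leeDr.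
have a3 : `|\sum_(j < K) Rintegral mu1 setT (psi j) - \sum_(j < K) Rintegral mu2 setT (psi j)| <= e.
  rewrite -sumrB; apply: (le_trans (ler_norm_sum _ _ _)).
  apply: (@le_trans _ _ (\sum_(j < K) W * (level_mass r alpha (k1 + j%:Z) *
      scaled_energy p Q f (k1 + j%:Z)))).
    apply: ler_sum => j _; rewrite WE.
    exact: active_part_bound (psiP _ (ltn_ord j)).
  rewrite -mulr_sumr mulrC -ler_pdivlMr//; exact: hk0.
exact: dist_approx a1 a2 a3.
Qed.

End main.

Theorem theorem1p8 (R : realType) (d : nat) (p q : R)
  (mu1 mu2 mu3 mu4 : {finite_measure set (d.-tuple R) -> \bar R}) :
  (1 <= d)%N -> 2 < p -> 1 <= q ->
  in_lorentz (fourier_abs mu1 mu2 mu3 mu4) p q ->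
  forall A : set (d.-tuple R), measurable A ->
  (NH (2 * d%:R / p) (dual_exp q * (2^-1)%:E)%E A < +oo)%E ->
  mu1 A = mu2 A /\ mu3 A = mu4 A.
Proof.
move=> d0 p2 q1 Lf A mA hA; split; first exact: real_part_vanishes Lf mA hA.
(* Multiplying the measure by i exchanges its real and imaginary parts. *)
have fE : fourier_abs mu4 mu3 mu1 mu2 = fourier_abs mu1 mu2 mu3 mu4.
  apply/funext => x; rewrite /fourier_abs; congr Num.sqrt.
  by rewrite /fourier_re /fourier_im; ring.
have Lf' : in_lorentz (fourier_abs mu4 mu3 mu1 mu2) p q by rewrite fE.
exact/esym/(real_part_vanishes d0 p2 q1 Lf' mA hA).
Qed.
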